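(* If $M$ is a connected smooth manifold of dimension $n$, then $\Pi(M)$ is a smooth manifold of dimension $2n$ (that is, the topological space $\Pi(M)$ carries a smooth manifold structure of dimension $2n$). Moreover, $s:\Pi(M)\to M$, $s([\gamma])=\gamma(0)$, is a smooth fiber bundle.
   Context: For a path connected, locally path connected and semilocally simply connected space $X$, an open subset $U\subseteq X$ is nice if it is path connected and the inclusion induces the trivial map $\pi_1(U,x)\to\pi_1(X,x)$ for every $x\in U$; the nice open sets form a basis of the topology. Let $I=[0,1]$. $\Pi(X)$ is the set of homotopy classes relative to endpoints $[\gamma]$ of paths $\gamma:I\to X$, with the topology having as basis the sets $S(U,V,[\gamma])=\{[\delta_1*\gamma*\delta_2]\}$, where $U,V\subseteq X$ are nice open sets, $\gamma$ is a path with $\gamma(0)\in U$ and $\gamma(1)\in V$, and $\delta_1$ (resp. $\delta_2$) ranges over the paths contained in $U$ ending at $\gamma(0)$ (resp. contained in $V$ starting at $\gamma(1)$); $*$ is concatenation. The map $s:\Pi(X)\to X$, $s([\gamma])=\gamma(0)$, is continuous, and for $x_0\in X$ the fiber $s^{-1}(x_0)$ is the universal cover of $X$ with base point $x_0$. *)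

(* Defs.v *)
From HB Require Import structures.
From mathcomp Require Import all_boot all_order all_algebra generic_quotient.
From mathcomp Require Import finmap all_classical all_reals.
From mathcomp Require Import topology normedtype derive homotopy.
From mathcomp Require Import lra.

Set Implicit Arguments.
Unset Strict Implicit.
Unset Printing Implicit Defensive.

Import Order.TTheory GRing.Theory Num.Theory.
Import numFieldTopology.Exports numFieldNormedType.Exports.

Local Open Scope classical_set_scope.
Local Open Scope ring_scope.
Local Open Scope quotient_scope.

Definition unit_interval (R : realType) : Type := set_type (`[0, 1]%classic : set R).

Section UnitInterval.
Context {R : realType}.
Local Notation I := (unit_interval R).

HB.instance Definition _ := Topological.copy I (set_type (`[0, 1]%classic : set R)).

(* [clip] retracts R onto [0,1]; it lets one evaluate a path at a real
   argument without carrying a proof that the argument lies in [0,1]. *)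
Definition clip_val (t : R) : R := Num.max 0 (Num.min 1 t).

Lemma clip_val_in t : clip_val t \in (`[0, 1]%classic : set R).
Proof.
rewrite inE/= in_itv/= /clip_val le_max lexx/= ge_max ler01/=.
by rewrite ge_min lexx.
Qed.

Definition clip (t : R) : I := exist _ (clip_val t) (clip_val_in t).

Definition ival (t : I) : R := set_val t.

Lemma ival_ge0 (t : I) : 0 <= ival t.
Proof. by case: t => t Pt; move: (set_mem Pt); rewrite /= in_itv/= => /andP[]. Qed.

Lemma ival_le1 (t : I) : ival t <= 1.
Proof. by case: t => t Pt; move: (set_mem Pt); rewrite /= in_itv/= => /andP[]. Qed.

Lemma ival_inj : injective ival.
Proof. by move=> s t; exact: val_inj. Qed.

Lemma clipK (t : R) : 0 <= t <= 1 -> ival (clip t) = t.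
Proof.
move=> /andP[t0 t1]; rewrite /ival set_valE/= /clip_val.
by rewrite (min_idPr t1); apply/max_idPr.
Qed.

Lemma ivalK : cancel ival clip.
Proof.
by move=> t; apply: ival_inj; rewrite clipK// ival_ge0 ival_le1.
Qed.

Lemma clip_le0 (t : R) : t <= 0 -> clip t = clip 0.
Proof.
move=> t0; apply: val_inj => /=; rewrite /clip_val.
by rewrite !max_l// ge_min ?t0 ?lexx ?orbT.
Qed.

Lemma clip_ge1 (t : R) : 1 <= t -> clip t = clip 1.
Proof. by move=> t1; apply: val_inj => /=; rewrite /clip_val !min_l. Qed.

Lemma ival_continuous : continuous ival.
Proof. exact: initial_continuous. Qed.

Lemma clip_continuous : continuous clip.
Proof.
apply/continuousP => A [B oB <-].
rewrite -comp_preimage; apply: open_comp oB => x _.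
rewrite /comp/= /clip_val; apply: (@continuous_max _ R (cst 0) (Num.min 1)).
  exact: cst_continuous.
apply: (@continuous_min _ R (cst 1) id); first exact: cst_continuous.
exact: cvg_id.
Qed.

Lemma clip01 : clip 0 != clip 1.
Proof.
apply/eqP => /(congr1 ival); rewrite !clipK ?lexx ?ler01// => /eqP.
by rewrite eq_sym oner_eq0.
Qed.

HB.instance Definition _ := isBiPointed.Build I clip01.

Lemma ival0 : ival (zero : I) = 0. Proof. by rewrite clipK ?lexx ?ler01. Qed.
Lemma ival1 : ival (one : I) = 1. Proof. by rewrite clipK ?lexx ?ler01. Qed.

End UnitInterval.

Lemma glue_continuous (R : realType) (T X : topologicalType) (u : T -> R)
    (f g : T -> X) :
  continuous u -> continuous f -> continuous g ->
  (forall t, u t = 1 / 2 -> f t = g t) ->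
  continuous (fun t => if u t <= 1 / 2 then f t else g t).
Proof.
move=> cu cf cg fg; set h := (fun t => _).
pose A := [set t | u t <= 1 / 2]; pose B := [set t | 1 / 2 <= u t].
have cA : closed A by apply: preimage_closed (@closed_le R (1 / 2)) => t _; exact: cu.
have cB : closed B by apply: preimage_closed (@closed_ge R (1 / 2)) => t _; exact: cu.
have hA : {within A, continuous h}.
  apply: (subspace_eq_continuous (f := f)); last exact: continuous_subspaceT.
  by move=> t; rewrite inE /A/= /from_subspace /h => ->.
have hB : {within B, continuous h}.
  apply: (subspace_eq_continuous (f := g)); last exact: continuous_subspaceT.
  move=> t; rewrite inE /B/= /from_subspace /h => ut.
  by case: ifP => // ut'; rewrite fg//; apply/eqP; rewrite eq_le ut ut'.
apply/continuous_subspace_setT; have -> : setT = A `|` B.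
  by rewrite eqEsubset; split=> // t _; case: (leP (u t) (1 / 2)) => [|/ltW]; [left|right].
exact: withinU_continuous.
Qed.

Lemma pair_continuous (T U V : topologicalType) (f : T -> U) (g : T -> V) :
  continuous f -> continuous g -> continuous (fun t => (f t, g t)).
Proof. by move=> cf cg t; apply: cvg_pair; [exact: cf|exact: cg]. Qed.

Lemma snd_continuous (T U : topologicalType) : continuous (@snd T U).
Proof. by move=> t; exact: cvg_snd. Qed.

Lemma affine_continuous (R : realType) (T : topologicalType) (u : T -> R)
    (a b : R) :
  continuous u -> continuous (fun t => a * u t + b).
Proof.
move=> cu t; apply: cvgD; first by apply: cvgMl_tmp; exact: cu.
by apply: (@cst_continuous T R b).
Qed.

Lemma scale_continuous (R : realType) (T : topologicalType) (u : T -> R)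
    (a : R) :
  continuous u -> continuous (fun t => a * u t).
Proof. by move=> cu t; apply: cvgMl_tmp; exact: cu. Qed.

Lemma clip_affine_continuous (R : realType) (T : topologicalType) (u : T -> R)
    (a b : R) :
  continuous u -> continuous (fun t => clip (a * u t + b)).
Proof.
move=> cu t; apply: (continuous_comp (f := fun t => a * u t + b)).
  exact: affine_continuous.
exact: clip_continuous.
Qed.

Lemma clip_scale_continuous (R : realType) (T : topologicalType) (u : T -> R)
    (a : R) :
  continuous u -> continuous (fun t => clip (a * u t)).
Proof.
move=> cu t; apply: (continuous_comp (f := fun t => a * u t)).
  exact: scale_continuous.
exact: clip_continuous.
Qed.

Lemma ival_fst_continuous (R : realType) :
  continuous (fun st : unit_interval R * unit_interval R => ival st.1).
Proof.
by move=> st; apply: (continuous_comp (f := fst)); [exact: cvg_fst|exact: ival_continuous].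
Qed.

Section Paths.
Context {R : realType} {X : topologicalType}.
Local Notation I := (unit_interval R).

Section concat.
Context {x y z : X} (p : {path I from x to y}) (q : {path I from y to z}).

Definition concat_fun (t : I) : X :=
  if ival t <= 1 / 2 then p (clip (2 * ival t)) else q (clip (2 * ival t - 1)).

Lemma concat_fun_continuous : continuous concat_fun.
Proof.
apply: (glue_continuous (u := ival) (f := fun t => p (clip (2 * ival t)))
  (g := fun t => q (clip (2 * ival t - 1)))).
- exact: ival_continuous.
- move=> t; apply: (continuous_comp (f := fun t => clip (2 * ival t))).
    exact: clip_scale_continuous ival_continuous _.
  exact: cts_fun.
- move=> t; apply: (continuous_comp (f := fun t => clip (2 * ival t - 1))).
    exact: clip_affine_continuous ival_continuous _.
  exact: cts_fun.
- move=> t ->; have -> : 2 * (1 / 2) = 1 :> R by lra.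
  by rewrite subrr [LHS]path_one [RHS]path_zero.
Qed.

Lemma concat_fun_zero : concat_fun zero = x.
Proof.
rewrite /concat_fun ival0 mulr0 ifT; last by lra.
exact: path_zero.
Qed.

Lemma concat_fun_one : concat_fun one = z.
Proof.
rewrite /concat_fun ival1 mulr1 ifF; last by apply/negbTE; rewrite -ltNge; lra.
have -> : 2 - 1 = 1 :> R by lra.
exact: path_one.
Qed.

Definition concat : {path I from x to z} :=
  mk_path concat_fun_continuous concat_fun_zero concat_fun_one.

Lemma concatE t : concat t = concat_fun t.
Proof. by []. Qed.

End concat.

Record free_path := FreePath {
  path_src : X;
  path_tgt : X;
  path_of :> {path I from path_src to path_tgt}
}.

HB.instance Definition _ := gen_eqMixin free_path.
HB.instance Definition _ := gen_choiceMixin free_path.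

(* Homotopy relative to endpoints; it forces [a] and [b] to have the same
   endpoints, see [homotopic_src] and [homotopic_tgt]. *)
Definition homotopic (a b : free_path) : Prop :=
  exists H : I * I -> X,
    [/\ continuous H,
        (forall t, H (zero, t) = a t),
        (forall t, H (one, t) = b t),
        (forall s, H (s, zero) = path_src a) &
        (forall s, H (s, one) = path_tgt a)].

Lemma homotopic_src a b : homotopic a b -> path_src a = path_src b.
Proof. by move=> [H [_ _ Hb H0 _]]; rewrite -(H0 one) Hb path_zero. Qed.

Lemma homotopic_tgt a b : homotopic a b -> path_tgt a = path_tgt b.
Proof. by move=> [H [_ _ Hb _ H1]]; rewrite -(H1 one) Hb path_one. Qed.

Lemma homotopic_refl a : homotopic a a.
Proof.
exists (fun st => a st.2); split => //=.
- move=> st; apply: (continuous_comp (f := snd)); first exact: cvg_snd.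
  exact: cts_fun.
- by move=> _; rewrite path_zero.
- by move=> _; rewrite path_one.
Qed.

Lemma homotopic_sym a b : homotopic a b -> homotopic b a.
Proof.
move=> ab; have [H [cH Ha Hb H0 H1]] := ab.
have r0 : clip (-1 * ival zero + 1) = one :> I by rewrite ival0 mulr0 add0r.
have r1 : clip (-1 * ival one + 1) = zero :> I by rewrite ival1 mulr1 addNr.
exists (fun st => H (clip (-1 * ival st.1 + 1), st.2)); split => /=.
- move=> st; apply: (continuous_comp (f := fun st => (clip (-1 * ival st.1 + 1), st.2))).
    apply: pair_continuous; last exact: snd_continuous.
    exact: clip_affine_continuous (@ival_fst_continuous R).
  exact: cH.
- by move=> t; rewrite r0 Hb.
- by move=> t; rewrite r1 Ha.
- by move=> s; rewrite H0 (homotopic_src ab).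
- by move=> s; rewrite H1 (homotopic_tgt ab).
Qed.

Lemma homotopic_trans b a c : homotopic a b -> homotopic b c -> homotopic a c.
Proof.
move=> ab bc; have [H [cH Ha Hb H0 H1]] := ab; have [G [cG Gb Gc G0 G1]] := bc.
exists (fun st => if ival st.1 <= 1 / 2 then H (clip (2 * ival st.1), st.2)
                  else G (clip (2 * ival st.1 - 1), st.2)); split => /=.
- apply: (glue_continuous (u := fun st : I * I => ival st.1)
    (f := fun st => H (clip (2 * ival st.1), st.2))
    (g := fun st => G (clip (2 * ival st.1 - 1), st.2))).
  + exact: ival_fst_continuous.
  + move=> st; apply: (continuous_comp (f := fun st => (clip (2 * ival st.1), st.2))).
      apply: pair_continuous; last exact: snd_continuous.
      exact: clip_scale_continuous (@ival_fst_continuous R).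
    exact: cH.
  + move=> st; apply: (continuous_comp (f := fun st => (clip (2 * ival st.1 - 1), st.2))).
      apply: pair_continuous; last exact: snd_continuous.
      exact: clip_affine_continuous (@ival_fst_continuous R).
    exact: cG.
  + move=> [s t]/= ->; have -> : 2 * (1 / 2) = 1 :> R by lra.
    by rewrite subrr Hb Gb.
- move=> t; rewrite ival0 mulr0 ifT; last by lra.
  exact: Ha.
- move=> t; rewrite ival1 mulr1 ifF; last by apply/negbTE; rewrite -ltNge; lra.
  have -> : 2 - 1 = 1 :> R by lra.
  exact: Gc.
- by move=> s; rewrite H0 G0 (homotopic_src ab); case: ifP.
- by move=> s; rewrite H1 G1 (homotopic_tgt ab); case: ifP.
Qed.

Lemma reparam_homotopic (x y : X) (p q : {path I from x to y}) (f : I -> R) :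
  continuous f -> f zero <= 0 -> 1 <= f one ->
  (forall t, q t = p (clip (f t))) -> homotopic (FreePath p) (FreePath q).
Proof.
move=> cf f0 f1 qE.
pose g (st : I * I) : R := (- 1 * ival st.1 + 1) * ival st.2 + ival st.1 * f st.2.
have c1 : continuous (fun st : I * I => ival st.1) by exact: ival_fst_continuous.
have c2 : continuous (fun st : I * I => ival st.2).
  by move=> st; apply: (continuous_comp (f := snd)); [exact: cvg_snd|exact: ival_continuous].
have c3 : continuous (fun st : I * I => f st.2).
  by move=> st; apply: (continuous_comp (f := snd)); [exact: cvg_snd|exact: cf].
have cg : continuous g.
  move=> st; apply: cvgD; last by apply: cvgM; [exact: c1|exact: c3].
  apply: cvgM; last exact: c2.
  apply: cvgD; first by apply: cvgMl_tmp; exact: c1.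
  by apply: (@cst_continuous _ R 1).
exists (fun st => p (clip (g st))); split => /=.
- move=> st; apply: (continuous_comp (f := fun st => clip (g st))).
    by apply: (continuous_comp (f := g)); [exact: cg|exact: clip_continuous].
  exact: cts_fun.
- by move=> t; rewrite /g/= ival0 mulr0 add0r mul1r mul0r addr0 ivalK.
- by move=> t; rewrite /g/= ival1 mulr1 addNr mul0r add0r mul1r qE.
- move=> s; rewrite /g/= ival0 mulr0 add0r clip_le0 ?path_zero//.
  by apply: mulr_ge0_le0 => //; exact: ival_ge0.
- move=> s; rewrite /g/= ival1 mulr1 clip_ge1 ?path_one//.
  have := ival_ge0 s; nra.
Qed.

Lemma concat_homotopic (x y z : X) (p p' : {path I from x to y})
    (q q' : {path I from y to z}) :
  homotopic (FreePath p) (FreePath p') -> homotopic (FreePath q) (FreePath q') ->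
  homotopic (FreePath (concat p q)) (FreePath (concat p' q')).
Proof.
move=> [H [cH /= Ha Hb H0 H1]] [G [cG /= Ga Gb G0 G1]].
have c2 : continuous (fun st : I * I => ival st.2).
  by move=> st; apply: (continuous_comp (f := snd)); [exact: cvg_snd|exact: ival_continuous].
have cfst : continuous (fst : I * I -> I) by move=> ?; exact: cvg_fst.
exists (fun st => if ival st.2 <= 1 / 2 then H (st.1, clip (2 * ival st.2))
                  else G (st.1, clip (2 * ival st.2 - 1))); split => /=.
- apply: (glue_continuous (u := fun st : I * I => ival st.2)
    (f := fun st => H (st.1, clip (2 * ival st.2)))
    (g := fun st => G (st.1, clip (2 * ival st.2 - 1)))) => //.
  + move=> st; apply: (continuous_comp (f := fun st => (st.1, clip (2 * ival st.2)))).
      by apply: pair_continuous => //; exact: clip_scale_continuous.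
    exact: cH.
  + move=> st; apply: (continuous_comp (f := fun st => (st.1, clip (2 * ival st.2 - 1)))).
      by apply: pair_continuous => //; exact: clip_affine_continuous.
    exact: cG.
  + move=> [s t]/= ->; have -> : 2 * (1 / 2) = 1 :> R by lra.
    by rewrite subrr [LHS]H1 [RHS]G0.
- by move=> t; rewrite Ha Ga.
- by move=> t; rewrite Hb Gb.
- move=> s; rewrite ival0 mulr0 ifT; last by lra.
  exact: H0.
- move=> s; rewrite ival1 mulr1 ifF; last by apply/negbTE; rewrite -ltNge; lra.
  have -> : 2 - 1 = 1 :> R by lra.
  exact: G1.
Qed.

Lemma concat_cstl (x y : X) (p : {path I from x to y}) :
  homotopic (FreePath p) (FreePath (concat (cst x : {path I from x to x}) p)).
Proof.
apply: (@reparam_homotopic _ _ _ _ (fun t => 2 * ival t - 1)).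
- by apply: affine_continuous; exact: ival_continuous.
- by rewrite ival0; lra.
- by rewrite ival1; lra.
- move=> t; rewrite /= !concatE /concat_fun; case: ifP => // t2.
  rewrite [RHS](congr1 p (clip_le0 _)); last by lra.
  by rewrite [RHS]path_zero.
Qed.

Lemma concat_cstr (x y : X) (p : {path I from x to y}) :
  homotopic (FreePath p) (FreePath (concat p (cst y : {path I from y to y}))).
Proof.
apply: (@reparam_homotopic _ _ _ _ (fun t => 2 * ival t)).
- by apply: scale_continuous; exact: ival_continuous.
- by rewrite ival0; lra.
- by rewrite ival1; lra.
- move=> t; rewrite /= !concatE /concat_fun; case: ifP => // /negbT; rewrite -ltNge => t2.
  rewrite [RHS](congr1 p (clip_ge1 _)); last by lra.
  by rewrite [RHS]path_one.
Qed.

Lemma concatA (x y z w : X) (p : {path I from x to y})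
    (q : {path I from y to z}) (r : {path I from z to w}) :
  homotopic (FreePath (concat (concat p q) r)) (FreePath (concat p (concat q r))).
Proof.
pose f (t : I) : R :=
  Num.max (1 / 2 * ival t) (Num.max (1 * ival t - 1 / 4) (2 * ival t - 1)).
have ci : continuous (ival : I -> R) by exact: ival_continuous.
apply: (@reparam_homotopic _ _ _ _ f).
- have c1 : continuous (fun t : I => 1 / 2 * ival t : R).
    exact: scale_continuous.
  have c2 : continuous (fun t : I => 1 * ival t - 1 / 4 : R).
    exact: affine_continuous.
  have c3 : continuous (fun t : I => 2 * ival t - 1 : R).
    exact: affine_continuous.
  have c4 := fun t : I => continuous_max (c2 t) (c3 t).
  by move=> t; exact: continuous_max (c1 t) (c4 t).
- by rewrite /f ival0 !ge_max; lra.
- by rewrite /f ival1 !le_max; lra.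
move=> t; rewrite /= !concatE /concat_fun.
have t0 := ival_ge0 t; have t1 := ival_le1 t.
have [t2|t2] := leP (ival t) (1 / 2).
  have fE : f t = 1 / 2 * ival t by apply/max_idPl; rewrite ge_max; lra.
  rewrite fE clipK; last lra.
  rewrite ifT; last lra.
  rewrite !concatE /concat_fun.
  have -> : 2 * (1 / 2 * ival t) = ival t by lra.
  by rewrite ivalK t2.
have [t3|t3] := leP (ival t) (3 / 4).
  have fE : f t = 1 * ival t - 1 / 4.
    rewrite /f (max_idPl _ : Num.max (1 * ival t - _) _ = _); last lra.
    by apply/max_idPr; lra.
  rewrite fE clipK; last lra.
  rewrite ifT; last lra.
  rewrite !concatE /concat_fun !clipK; [|lra|lra].
  rewrite ifT; last lra.
  rewrite ifF; last by apply/negbTE; rewrite -ltNge; lra.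
  by congr (q (clip _)); lra.
have fE : f t = 2 * ival t - 1.
  rewrite /f (max_idPr _ : Num.max (1 * ival t - _) _ = _); last lra.
  by apply/max_idPr; lra.
rewrite fE clipK; last lra.
rewrite ifF; last by apply/negbTE; rewrite -ltNge; lra.
rewrite !concatE /concat_fun clipK; last lra.
by rewrite ifF//; apply/negbTE; rewrite -ltNge; lra.
Qed.

Lemma homotopic_equiv : equiv_class_of (fun a b => `[< homotopic a b >]).
Proof.
split.
- by move=> a; apply/asboolP; exact: homotopic_refl.
- by move=> a b; apply/asboolP/asboolP; exact: homotopic_sym.
- move=> b a c /asboolP ab /asboolP bc; apply/asboolP.
  exact: homotopic_trans ab bc.
Qed.

Definition homotopic_rel := EquivRelPack homotopic_equiv.

End Paths.
Arguments free_path : clear implicits.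
Arguments homotopic_rel : clear implicits.

Definition Pi (R : realType) (X : topologicalType) : Type :=
  {eq_quot (homotopic_rel R X)}.

Section PiSpace.
Context {R : realType} {X : topologicalType}.
Local Notation I := (unit_interval R).

HB.instance Definition _ := Quotient.on (Pi R X).
HB.instance Definition _ := Choice.on (Pi R X).

Definition hclass {x y : X} (p : {path I from x to y}) : Pi R X :=
  \pi_(Pi R X) (FreePath p).

Lemma hclassP (x y x' y' : X) (p : {path I from x to y})
    (q : {path I from x' to y'}) :
  hclass p = hclass q <-> homotopic (FreePath p) (FreePath q).
Proof.
by split=> [/eqmodP/asboolP//|pq]; apply/eqmodP/asboolP.
Qed.

Definition Pi_src (a : Pi R X) : X := path_src (repr a).

Lemma Pi_src_hclass (x y : X) (p : {path I from x to y}) :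
  Pi_src (hclass p) = p zero.
Proof.
rewrite path_zero /Pi_src /hclass; case: piP => b /eqmodP/asboolP.
by move/homotopic_src => /= <-.
Qed.

Definition path_connected (U : set X) : Prop :=
  forall x y, U x -> U y ->
    exists p : {path I from x to y}, range p `<=` U.

(* The last clause says that the inclusion induces the trivial map
   pi_1(U, x) -> pi_1(X, x). *)
Definition nice (U : set X) : Prop :=
  [/\ open U, path_connected U &
      forall (x : X) (p : {path I from x to x}), U x -> range p `<=` U ->
        hclass p = hclass (cst x : {path I from x to x})].

(* The set written S(U, V, [p]) in the literature. *)
Definition Pi_basic (U V : set X) (x y : X) (p : {path I from x to y}) :
    set (Pi R X) :=
  [set a | exists x' y' (d1 : {path I from x' to x}) (d2 : {path I from y to y'}),
    [/\ range d1 `<=` U, range d2 `<=` V & a = hclass (concat (concat d1 p) d2)]].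

Definition Pi_base : set (set (Pi R X)) :=
  [set S | exists U V x y (p : {path I from x to y}),
    [/\ nice U, nice V, U x, V y & S = Pi_basic U V p]].

(* The topology generated by [Pi_base]. By [Pi_base_basis] below, [Pi_base] is
   a basis of it as soon as the nice open sets form a basis of [X]. *)
HB.instance Definition _ := isSubBaseTopological.Build (Pi R X) Pi_base id.

Lemma hclass_concat (x y z : X) (p p' : {path I from x to y})
    (q q' : {path I from y to z}) :
  hclass p = hclass p' -> hclass q = hclass q' ->
  hclass (concat p q) = hclass (concat p' q').
Proof. by rewrite !hclassP; exact: concat_homotopic. Qed.

Lemma hclassA (x y z w : X) (p : {path I from x to y})
    (q : {path I from y to z}) (r : {path I from z to w}) :
  hclass (concat (concat p q) r) = hclass (concat p (concat q r)).
Proof. by apply/hclassP; exact: concatA. Qed.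

Lemma range_concat (x y z : X) (p : {path I from x to y})
    (q : {path I from y to z}) (U : set X) :
  range p `<=` U -> range q `<=` U -> range (concat p q) `<=` U.
Proof.
move=> pU qU _ [t _ <-]; rewrite concatE /concat_fun.
by case: ifP => _; [apply: pU|apply: qU]; eexists.
Qed.

Lemma Pi_basic_self (U V : set X) (x y : X) (p : {path I from x to y}) :
  U x -> V y -> Pi_basic U V p (hclass p).
Proof.
move=> Ux Vy; exists x, y, (cst x), (cst y); split.
- by move=> _ [t _ <-].
- by move=> _ [t _ <-].
apply/hclassP; apply: homotopic_trans (concat_cstr _).
exact: concat_cstl.
Qed.

Lemma Pi_basicW (U V U' V' : set X) (x y x' y' : X) (p : {path I from x to y})
    (q : {path I from x' to y'}) :
  U' `<=` U -> V' `<=` V -> Pi_basic U V p (hclass q) ->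
  Pi_basic U' V' q `<=` Pi_basic U V p.
Proof.
move=> U'U V'V [x1 [y1 [d1 [d2 [d1U d2V qE]]]]] _ [x2 [y2 [e1 [e2 [e1U e2V ->]]]]].
have /homotopic_src/= x1E := (hclassP _ _).1 qE.
have /homotopic_tgt/= y1E := (hclassP _ _).1 qE.
subst x1 y1; exists x2, y2, (concat e1 d1), (concat d2 e2); split.
- by apply: range_concat => //; exact: subset_trans e1U U'U.
- by apply: range_concat => //; exact: subset_trans e2V V'V.
rewrite (hclass_concat (hclass_concat (erefl (hclass e1)) qE) (erefl (hclass e2))).
rewrite hclassA (hclass_concat (erefl _) (hclassA _ _ _)) -hclassA.
apply: hclass_concat => //.
by rewrite -hclassA; apply: hclass_concat => //; rewrite hclassA.
Qed.

Lemma Pi_base_basis : basis (nice : set (set X)) -> basis Pi_base.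
Proof.
move=> [niceo nicen].
have nbasis (x : X) (A : set X) : open A -> A x -> exists W, [/\ nice W, W x & W `<=` A].
  move=> oA Ax; have [W [nW Wx] WA] := nicen x A (open_nbhs_nbhs (conj oA Ax)).
  by exists W.
have cover (a : Pi R X) : exists2 S, Pi_base S & S a.
  rewrite -[a]reprK; case: (repr a) => x y p.
  have [U [nU Ux _]] := nbasis x setT openT Logic.I.
  have [V [nV Vy _]] := nbasis y setT openT Logic.I.
  exists (Pi_basic U V p); last exact: Pi_basic_self.
  by exists U, V, x, y, p.
have inter (S S' : set (Pi R X)) a : Pi_base S -> Pi_base S' -> S a -> S' a ->
    exists2 T, Pi_base T /\ T a & T `<=` S `&` S'.
  move=> [U [V [x [y [p [nU nV Ux Vy ->]]]]]] [U' [V' [x' [y' [p' [nU' nV' Ux' Vy' ->]]]]]].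
  rewrite -[a]reprK; case: (repr a) => z w q.
  have ends (A B : set X) u v (r : {path I from u to v}) :
      Pi_basic A B r (hclass q) -> A z /\ B w.
    move=> [z1 [w1 [d1 [d2 [d1A d2B /hclassP qE]]]]].
    have /= -> := homotopic_src qE; have /= -> := homotopic_tgt qE.
    split.
      by apply: d1A; exists zero => //; rewrite path_zero.
    by apply: d2B; exists one => //; rewrite path_one.
  move=> Sq S'q; have [Uz Vw] := ends _ _ _ _ _ Sq; have [U'z V'w] := ends _ _ _ _ _ S'q.
  have [W [nW Wz WU]] := nbasis z _ (openI (niceo _ nU) (niceo _ nU')) (conj Uz U'z).
  have [Y [nY Yw YV]] := nbasis w _ (openI (niceo _ nV) (niceo _ nV')) (conj Vw V'w).
  exists (Pi_basic W Y q).
    split; last exact: Pi_basic_self.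
    by exists W, Y, z, w, q.
  have [WU0 WU1] : W `<=` U /\ W `<=` U' by split=> u /WU[].
  have [YV0 YV1] : Y `<=` V /\ Y `<=` V' by split=> u /YV[].
  move=> b Tb; split; first exact: Pi_basicW Sq _ Tb.
  exact: Pi_basicW S'q _ Tb.
split.
  move=> S bS; exists [set S]; last by rewrite bigcup_set1.
  move=> _ ->; exists [fset S]%fset; last by rewrite set_fset1 bigcap_set1.
  by move=> T /fset1P ->; rewrite inE.
move=> a A; rewrite nbhsE => -[B [[D Dsub DB] Ba] BA].
have [C DC Ca] : (\bigcup_(i in D) i) a by rewrite DB.
suff [T [bT Ta] TC] : exists2 T, Pi_base T /\ T a & T `<=` C.
  by exists T => // b /TC Cb; apply: BA; rewrite -DB; exists C.
have [F Fsub FC] := Dsub _ DC.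
have {}Fsub S : S \in F -> Pi_base S by move=> /Fsub; rewrite inE.
rewrite -FC in Ca *.
elim/finSet_rect: F Fsub Ca {FC} => F IH Fsub Ca.
have [F0|[S SF]] := fset_0Vmem F.
  have [T bT Ta] := cover a; exists T => // b _ S /=.
  by rewrite F0 inE.
have := IH (F `\ S)%fset (fproperD1 SF).
case.
- by move=> T; rewrite in_fsetD1 => /andP[_]; exact: Fsub.
- by move=> T; rewrite /= in_fsetD1 => /andP[_]; exact: Ca.
move=> T [bT Ta] TC.
have [T' bT' T'S] := inter _ _ a bT (Fsub _ SF) Ta (Ca _ SF).
exists T' => // b /T'S[Tb Sb] S' /= S'F.
have [->//|S'S] := eqVneq S' S.
by apply: TC => //; rewrite /= in_fsetD1 S'S.
Qed.

End PiSpace.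

Section SmoothEuclidean.
Context {R : realType} {m k : nat}.

(* On an open set [U]: the iterated partial derivatives of [f] of order at most
   [r] exist and are continuous. *)
Fixpoint Cr (r : nat) (U : set 'rV[R]_m) (f : 'rV[R]_m -> 'rV[R]_k) : Prop :=
  (forall x, U x -> {for x, continuous f}) /\
  match r with
  | 0%N => True
  | r'.+1 => forall i : 'I_m,
      (forall x, U x -> derivable f x (delta_mx 0 i)) /\
      Cr r' U ('D_(delta_mx 0 i) f)
  end.

Definition Cinfty (U : set 'rV[R]_m) (f : 'rV[R]_m -> 'rV[R]_k) : Prop :=
  forall r, Cr r U f.

End SmoothEuclidean.

(* A homeomorphism between open subsets of [T] and [R^n]; outside these subsets
   the values of the two functions are irrelevant. *)
Record chart (R : realType) (n : nat) (T : topologicalType) := Chart {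
  chart_dom : set T;
  chart_cod : set 'rV[R]_n;
  chart_map : T -> 'rV[R]_n;
  chart_inv : 'rV[R]_n -> T;
  chart_dom_open : open chart_dom;
  chart_cod_open : open chart_cod;
  chart_mapP : forall x, chart_dom x -> chart_cod (chart_map x);
  chart_invP : forall v, chart_cod v -> chart_dom (chart_inv v);
  chart_mapK : forall x, chart_dom x -> chart_inv (chart_map x) = x;
  chart_invK : forall v, chart_cod v -> chart_map (chart_inv v) = v;
  chart_map_cts : forall x, chart_dom x -> {for x, continuous chart_map};
  chart_inv_cts : forall v, chart_cod v -> {for v, continuous chart_inv}
}.

Section Manifolds.
Context {R : realType}.

Definition smooth_compatible (n : nat) (T : topologicalType)
    (c d : chart R n T) : Prop :=
  Cinfty (chart_cod c `&` chart_inv c @^-1` chart_dom d)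
    (chart_map d \o chart_inv c).

Definition smooth_atlas (n : nat) (T : topologicalType)
    (A : set (chart R n T)) : Prop :=
  (forall x, exists2 c, A c & chart_dom c x) /\
  (forall c d, A c -> A d -> smooth_compatible c d).

(* The smooth structure is the one determined by the atlas [A], which is not
   required to be maximal. *)
Definition smooth_manifold (n : nat) (T : topologicalType)
    (A : set (chart R n T)) : Prop :=
  [/\ hausdorff_space T, @second_countable T & smooth_atlas A].

(* Meant for [W] open. *)
Definition smooth_on (m n : nat) (S T : topologicalType)
    (A : set (chart R m S)) (B : set (chart R n T)) (W : set S) (f : S -> T) :
    Prop :=
  (forall x, W x -> {for x, continuous f}) /\
  (forall c d, A c -> B d ->
    Cinfty (chart_cod c `&`
            chart_inv c @^-1` (W `&` chart_dom c `&` f @^-1` chart_dom d))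
      (chart_map d \o f \o chart_inv c)).

Definition diffeomorphism_on (m n : nat) (S T : topologicalType)
    (A : set (chart R m S)) (B : set (chart R n T))
    (W : set S) (W' : set T) (f : S -> T) (g : T -> S) : Prop :=
  [/\ open W /\ open W',
      (forall x, W x -> W' (f x) /\ g (f x) = x),
      (forall y, W' y -> W (g y) /\ f (g y) = y),
      smooth_on A B W f &
      smooth_on B A W' g].

Section ProductChart.
Context {m n : nat} {S T : topologicalType}.
Context (c : chart R m S) (d : chart R n T).

Let dom : set (S * T) := chart_dom c `*` chart_dom d.
Let cod : set 'rV[R]_(m + n) :=
  [set v | chart_cod c (lsubmx v) /\ chart_cod d (rsubmx v)].
Let map (xy : S * T) : 'rV[R]_(m + n) :=
  row_mx (chart_map c xy.1) (chart_map d xy.2).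
Let inv (v : 'rV[R]_(m + n)) : S * T :=
  (chart_inv c (lsubmx v), chart_inv d (rsubmx v)).

Let lsubmx_continuous : continuous (fun v : 'rV[R]_(m + n) => lsubmx v).
Proof.
move=> v B /nbhs_ballP[e e0 eB]; apply/nbhs_ballP; exists e => // w vw.
by apply: eB; split=> // i j; rewrite !mxE; exact: vw.2.
Qed.

Let rsubmx_continuous : continuous (fun v : 'rV[R]_(m + n) => rsubmx v).
Proof.
move=> v B /nbhs_ballP[e e0 eB]; apply/nbhs_ballP; exists e => // w vw.
by apply: eB; split=> // i j; rewrite !mxE; exact: vw.2.
Qed.

Let dom_open : open dom.
Proof.
rewrite openE => -[x y] [/= dx dy]; exists (chart_dom c, chart_dom d) => //.
by split; apply: open_nbhs_nbhs; split=> //; exact: chart_dom_open.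
Qed.

Let cod_open : open cod.
Proof.
apply: openI.
- apply: (@open_comp _ _ (fun v : 'rV[R]_(m + n) => lsubmx v)).
    by move=> v _; exact: lsubmx_continuous.
  exact: chart_cod_open.
- apply: (@open_comp _ _ (fun v : 'rV[R]_(m + n) => rsubmx v)).
    by move=> v _; exact: rsubmx_continuous.
  exact: chart_cod_open.
Qed.

Let mapP xy : dom xy -> cod (map xy).
Proof.
by move=> [? ?]; split; rewrite ?row_mxKl ?row_mxKr; exact: chart_mapP.
Qed.

Let invP v : cod v -> dom (inv v).
Proof. by move=> [? ?]; split; exact: chart_invP. Qed.

Let mapK xy : dom xy -> inv (map xy) = xy.
Proof.
case: xy => x y [? ?].
by rewrite /inv /map row_mxKl row_mxKr !chart_mapK.
Qed.

Let invK v : cod v -> map (inv v) = v.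
Proof. by move=> [? ?]; rewrite /inv /map/= !chart_invK// hsubmxK. Qed.

Let map_cts xy : dom xy -> {for xy, continuous map}.
Proof.
case: xy => x y [/= dx dy] B /nbhs_ballP[e e0 eB].
have /= cx := chart_map_cts dx (nbhsx_ballx _ _ e0).
have /= cy := chart_map_cts dy (nbhsx_ballx _ _ e0).
exists (chart_map c @^-1` ball (chart_map c x) e,
        chart_map d @^-1` ball (chart_map d y) e) => //= -[x' y'] [/= bx by_].
apply: eB; split=> // i j; rewrite !mxE.
by case: (fintype.split j) => j'; [exact: bx.2|exact: by_.2].
Qed.

Let inv_cts v : cod v -> {for v, continuous inv}.
Proof.
move=> [cl cr].
have c1 := cvg_comp _ _ (@lsubmx_continuous v) (chart_inv_cts cl).
have c2 := cvg_comp _ _ (@rsubmx_continuous v) (chart_inv_cts cr).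
move=> B [[P Q] [/= Pv Qv] PQB].
change (nbhs v (inv @^-1` B)).
apply: (@filterS _ _ _ (fun w => P (inv w).1 /\ Q (inv w).2)).
  by move=> w; exact: PQB.
apply: (@filterI _ _ _ (fun w => P (inv w).1) (fun w => Q (inv w).2)).
  exact: c1.
exact: c2.
Qed.

Definition prod_chart : chart R (m + n) (S * T)%type :=
  Chart dom_open cod_open mapP invP mapK invK map_cts inv_cts.

End ProductChart.

Definition prod_atlas (m n : nat) (S T : topologicalType)
    (A : set (chart R m S)) (B : set (chart R n T)) :
    set (chart R (m + n) (S * T)%type) :=
  [set e | exists c d, [/\ A c, B d & e = prod_chart c d]].

(* [f] and [g] are the inverse local trivializations over [U]; only their
   restrictions to [p @^-1` U] and [U `*` setT] matter. *)
Definition smooth_fiber_bundle (m n : nat) (E B : topologicalType)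
    (AE : set (chart R m E)) (AB : set (chart R n B)) (p : E -> B) : Prop :=
  [/\ smooth_on AE AB setT p,
      (forall b, exists e, p e = b) &
      exists (k : nat) (F : topologicalType) (AF : set (chart R k F)),
        smooth_manifold AF /\
        forall b, exists (U : set B) (f : E -> B * F) (g : B * F -> E),
          [/\ open U, U b,
              diffeomorphism_on AE (prod_atlas AB AF)
                (p @^-1` U) (U `*` setT) f g &
              forall e, U (p e) -> (f e).1 = p e]].

End Manifolds.

(* Main.v *)
(* (src, tgt) : Pi(M) -> M x M is a local homeomorphism: it maps a basic set
   S(U, V, [p]) bijectively onto U x V, because two paths with the same
   endpoints in a nice open set are homotopic in M. Composing it with pairs of
   charts of M gives an atlas of Pi(M) whose transition maps are products of
   transition maps of M, and the same charts with the source frozen give an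
   atlas of the fiber F over a point x0. Concatenation makes Pi(M) a topological
   groupoid; if kappa is a continuous choice of classes of paths from x0 to the
   points of a nice open set U, then a |-> (src a, kappa (src a) * a)
   trivializes src over U; it preserves targets, so that in charts
   it is again a product of transition maps of M.
   Pi(M) is second countable because, given a countable basis of nice open sets
   with a chosen point in each, every path is homotopic, up to short paths at
   both ends, to a finite chain of small paths between chosen points, and there
   are countably many such chains. *)

Require Import Defs.
From mathcomp Require Import all_boot all_order all_algebra.
From mathcomp Require Import all_classical all_reals.
From mathcomp Require Import topology normedtype derive homotopy.
From mathcomp Require Import lra.

Set Implicit Arguments.
Unset Strict Implicit.
Unset Printing Implicit Defensive.

Import Order.TTheory GRing.Theory Num.Theory.
Import numFieldTopology.Exports numFieldNormedType.Exports.

Local Open Scope classical_set_scope.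
Local Open Scope ring_scope.

(** * Paths and homotopies *)

Section Paths.
Context {R : realType} {X : topologicalType}.
Local Notation I := (unit_interval R).

(** The straight-line homotopy from [f] to [g] in [E], pushed forward by [P]. Continuity of [P] is
    asked only at the points of the segments, so that [P] may be the inverse of a chart. *)
Lemma homotopic_factor (E : normedModType R) (P : E -> X) (f g : I -> E)
    (x y : X) (p q : {path I from x to y}) :
  continuous f -> continuous g ->
  (forall s t : I,
    {for (1 - ival s) *: f t + ival s *: g t, continuous P}) ->
  f zero = g zero -> f one = g one ->
  (forall t, p t = P (f t)) -> (forall t, q t = P (g t)) ->
  homotopic (FreePath p) (FreePath q).
Proof.
move=> cf cg cP fg0 fg1 pE qE.
have convE (v : E) (s : I) : (1 - ival s) *: v + ival s *: v = v.
  by rewrite -scalerDl subrK scale1r.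
exists (fun st => P ((1 - ival st.1) *: f st.2 + ival st.1 *: g st.2)).
split => /=.
- move=> st.
  apply: (continuous_comp
    (f := fun st : I * I => (1 - ival st.1) *: f st.2 + ival st.1 *: g st.2));
    last exact: cP.
  have cs : continuous (fun st : I * I => ival st.1).
    exact: ival_fst_continuous.
  apply: cvgD.
    apply: (@cvgZ _ _ _ _ _ (fun st : I * I => 1 - ival st.1)
      (fun st : I * I => f st.2)).
      by apply: cvgB; [exact: cvg_cst|exact: cs].
    by apply: (continuous_comp (f := snd)); [exact: cvg_snd|exact: cf].
  apply: (@cvgZ _ _ _ _ _ (fun st : I * I => ival st.1)
      (fun st : I * I => g st.2)).
    exact: cs.
  by apply: (continuous_comp (f := snd)); [exact: cvg_snd|exact: cg].
- by move=> t; rewrite ival0 subr0 scale1r scale0r addr0 pE.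
- by move=> t; rewrite ival1 subrr scale0r scale1r add0r qE.
- by move=> s; rewrite -fg0 convE -pE path_zero.
- by move=> s; rewrite -fg1 convE -pE path_one.
Qed.

Lemma homotopic_reparam (P : R -> X) (f g : I -> R) (x y : X)
    (p q : {path I from x to y}) :
  continuous P -> continuous f -> continuous g ->
  f zero = g zero -> f one = g one ->
  (forall t, p t = P (f t)) -> (forall t, q t = P (g t)) ->
  homotopic (FreePath p) (FreePath q).
Proof.
move=> cP cf cg; apply: (@homotopic_factor R^o P f g) => //.
by move=> s t; exact: cP.
Qed.

Section rev_path.
Context {x y : X} (p : {path I from x to y}).

Definition rev_path_fun (t : I) : X := p (clip (-1 * ival t + 1)).

Lemma rev_path_continuous : continuous rev_path_fun.
Proof.
move=> t; apply: (continuous_comp (f := fun t => clip (-1 * ival t + 1))).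
  exact: clip_affine_continuous ival_continuous _.
exact: cts_fun.
Qed.

Lemma rev_path_zero : rev_path_fun zero = y.
Proof. by rewrite /rev_path_fun ival0 mulr0 add0r; exact: path_one. Qed.

Lemma rev_path_one : rev_path_fun one = x.
Proof. by rewrite /rev_path_fun ival1 mulr1 addNr; exact: path_zero. Qed.

Definition rev_path : {path I from y to x} :=
  mk_path rev_path_continuous rev_path_zero rev_path_one.

Lemma rev_pathE t : rev_path t = p (clip (-1 * ival t + 1)).
Proof. by []. Qed.

End rev_path.

Lemma range_rev_path (x y : X) (p : {path I from x to y}) (U : set X) :
  range p `<=` U -> range (rev_path p) `<=` U.
Proof. by move=> pU _ [t _ <-]; apply: pU; eexists. Qed.

Lemma rev_path_homotopic (x y : X) (p q : {path I from x to y}) :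
  homotopic (FreePath p) (FreePath q) ->
  homotopic (FreePath (rev_path p)) (FreePath (rev_path q)).
Proof.
move=> [H [cH /= Hp Hq H0 H1]].
exists (fun st => H (st.1, clip (-1 * ival st.2 + 1))); split => /=.
- move=> st; apply: (continuous_comp
    (f := fun st : I * I => (st.1, clip (-1 * ival st.2 + 1))));
    last exact: cH.
  apply: pair_continuous; first by move=> ?; exact: cvg_fst.
  apply: clip_affine_continuous => {}st.
  by apply: (continuous_comp (f := snd)); [exact: cvg_snd|exact: ival_continuous].
- by move=> t; rewrite Hp.
- by move=> t; rewrite Hq.
- by move=> s; rewrite ival0 mulr0 add0r; exact: H1.
- by move=> s; rewrite ival1 mulr1 addNr; exact: H0.
Qed.

Lemma concat_rev_path (x y : X) (p : {path I from x to y}) :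
  homotopic (FreePath (concat p (rev_path p)))
    (FreePath (cst x : {path I from x to x})).
Proof.
(* The tent function rises from 0 to 1 and falls back to 0, so [p] composed with it runs along [p]
   and returns. It has the same end values as the constant 0, to which it can therefore be
   deformed. *)
pose f (t : I) : R := Num.min (2 * ival t) (-2 * ival t + 2).
apply: (@homotopic_reparam (p \o clip) f (cst 0)).
- move=> t; apply: continuous_comp; first exact: clip_continuous.
  exact: cts_fun.
- move=> t; apply: (@continuous_min R I (fun t => 2 * ival t)
    (fun t => -2 * ival t + 2)).
    exact: (Defs.scale_continuous ival_continuous).
  exact: (affine_continuous ival_continuous).
- exact: cst_continuous.
- by rewrite /f ival0 mulr0 minEle mulr0 add0r ler0n.
- by rewrite /f ival1 /= mulr1 mulr1 addNr; apply/min_idPr; exact: ler0n.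
- move=> t; rewrite concatE /concat_fun /f /= minEle.
  case: ifPn => t2; first by rewrite ifT//; lra.
  rewrite -ltNge in t2; rewrite ifF; last by apply/negbTE; rewrite -ltNge; lra.
  rewrite rev_pathE clipK; last by have := ival_le1 t; lra.
  by congr (p (clip _)); lra.
- by move=> t /=; rewrite [RHS]path_zero.
Qed.

Lemma rev_pathK (x y : X) (p : {path I from x to y}) :
  rev_path (rev_path p) = p.
Proof.
apply/path_eqP => t; rewrite !rev_pathE.
have t0 := ival_ge0 t; have t1 := ival_le1 t.
rewrite clipK; last by lra.
by congr (p _); apply: ival_inj; rewrite clipK; lra.
Qed.

End Paths.

(** * Arcs of a map from the real line *)

Section Arc.
Context {R : realType} {X : topologicalType}.
Local Notation I := (unit_interval R).
Context (P : R -> X) (cP : continuous P).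

(** The case [b < a] is allowed; the arc then runs backwards. *)
Definition arc_fun (a b : R) (t : I) : X := P ((b - a) * ival t + a).

Lemma arc_continuous a b : continuous (arc_fun a b).
Proof.
move=> t; apply: (continuous_comp (f := fun t => (b - a) * ival t + a)).
  exact: (affine_continuous ival_continuous).
exact: cP.
Qed.

Lemma arc_zero a b : arc_fun a b zero = P a.
Proof. by rewrite /arc_fun ival0 mulr0 add0r. Qed.

Lemma arc_one a b : arc_fun a b one = P b.
Proof. by rewrite /arc_fun ival1 mulr1 subrK. Qed.

Definition arc a b : {path I from P a to P b} :=
  mk_path (@arc_continuous a b) (arc_zero a b) (arc_one a b).

Lemma arcE a b t : arc a b t = P ((b - a) * ival t + a).
Proof. by []. Qed.

(** Both sides are [P] after functions from [I] to the line with end values [a] and [c], so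
    [homotopic_reparam] applies. *)
Lemma hclass_arc a b c : hclass (concat (arc a b) (arc b c)) = hclass (arc a c).
Proof.
apply/hclassP; pose f (t : I) : R :=
  if ival t <= 1 / 2 then (b - a) * (2 * ival t) + a
  else (c - b) * (2 * ival t - 1) + b.
apply: (@homotopic_reparam _ _ P f (fun t => (c - a) * ival t + a)) => //.
- apply: (@glue_continuous _ _ _ ival (fun t => (b - a) * (2 * ival t) + a)
    (fun t => (c - b) * (2 * ival t - 1) + b)).
  + exact: ival_continuous.
  + by apply: affine_continuous; apply: Defs.scale_continuous; exact: ival_continuous.
  + by apply: affine_continuous; apply: affine_continuous; exact: ival_continuous.
  + by move=> t ->; lra.
- exact: (affine_continuous ival_continuous).
- by rewrite /f ival0 ifT; lra.
- by rewrite /f ival1 ifF; [lra|apply/negbTE; rewrite -ltNge; lra].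
- move=> t; rewrite concatE /concat_fun /f.
  have t0 := ival_ge0 t; have t1 := ival_le1 t.
  case: ifPn => t2; rewrite arcE clipK//; first by lra.
  by rewrite -ltNge in t2; lra.
Qed.

End Arc.

(** * The groupoid structure on Pi *)

Section Groupoid.
Context {R : realType} {X : topologicalType}.
Local Notation I := (unit_interval R).
Local Notation Pi := (Pi R X).
Implicit Types (a b c : Pi) (U V W : set X).

Definition Pi_tgt a : X := path_tgt (repr a).
Local Notation src := (@Pi_src R X).
Local Notation tgt := Pi_tgt.
Local Notation nice := (@nice R X).

Lemma src_hclass (x y : X) (p : {path I from x to y}) : src (hclass p) = x.
Proof. by rewrite Pi_src_hclass path_zero. Qed.

Lemma hclass_repr a : a = hclass (path_of (repr a)).
Proof. by rewrite -[LHS]reprK /hclass; case: (repr a). Qed.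

Lemma tgt_hclass (x y : X) (p : {path I from x to y}) : tgt (hclass p) = y.
Proof.
exact: esym (homotopic_tgt ((hclassP _ _).1 (hclass_repr (hclass p)))).
Qed.

Lemma Pi_ind (Q : Pi -> Prop) :
  (forall x y (p : {path I from x to y}), Q (hclass p)) -> forall a, Q a.
Proof. by move=> h a; rewrite (hclass_repr a). Qed.

Lemma hclass_ind_from (x : X) (Q : Pi -> Prop) :
  (forall y (p : {path I from x to y}), Q (hclass p)) ->
  forall a, src a = x -> Q a.
Proof. by move=> h; elim/Pi_ind => x' y p; rewrite src_hclass => xE; subst. Qed.

Definition Pi_id (x : X) : Pi := hclass (cst x : {path I from x to x}).

Definition Pi_inv a : Pi := hclass (rev_path (path_of (repr a))).

(* Meaningful only when [tgt a = src b]; the value is [a] otherwise. *)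
Definition Pi_mul a b : Pi :=
  xget a [set c | exists x y z (p : {path I from x to y}) (q : {path I from y to z}),
    [/\ a = hclass p, b = hclass q & c = hclass (concat p q)]].
Local Notation "a ** b" := (Pi_mul a b) (at level 40, left associativity).

(** The representatives picked by [xget] do not matter: equal classes have equal endpoints, so the
    path types can be identified, and concatenation respects homotopy. *)
Lemma mul_hclass (x y z : X) (p : {path I from x to y})
    (q : {path I from y to z}) : hclass p ** hclass q = hclass (concat p q).
Proof.
rewrite /Pi_mul; case: xgetP => [c _|/(_ (hclass (concat p q)))]; last first.
  by case; exists x, y, z, p, q.
move=> [x' [y' [z' [p' [q' [pE qE ->]]]]]].
have /= xE := homotopic_src ((hclassP _ _).1 pE).
have /= yE := homotopic_tgt ((hclassP _ _).1 pE).
have /= zE := homotopic_tgt ((hclassP _ _).1 qE).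
by subst x' y' z'; apply/esym/hclass_concat.
Qed.

Lemma inv_hclass (x y : X) (p : {path I from x to y}) :
  Pi_inv (hclass p) = hclass (rev_path p).
Proof.
rewrite /Pi_inv; have := hclass_repr (hclass p).
case: (repr (hclass p)) => x' y' p' /= pE.
have /= xE := homotopic_src ((hclassP _ _).1 pE).
have /= yE := homotopic_tgt ((hclassP _ _).1 pE).
subst x' y'; apply/hclassP/rev_path_homotopic/homotopic_sym.
exact: (hclassP _ _).1.
Qed.

Lemma src_id x : src (Pi_id x) = x. Proof. exact: src_hclass. Qed.
Lemma tgt_id x : tgt (Pi_id x) = x. Proof. exact: tgt_hclass. Qed.

Lemma src_inv a : src (Pi_inv a) = tgt a.
Proof. by elim/Pi_ind: a => x y p; rewrite inv_hclass src_hclass tgt_hclass. Qed.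

Lemma tgt_inv a : tgt (Pi_inv a) = src a.
Proof. by elim/Pi_ind: a => x y p; rewrite inv_hclass src_hclass tgt_hclass. Qed.

Lemma Pi_ind2 (Q : Pi -> Pi -> Prop) :
  (forall x y z (p : {path I from x to y}) (q : {path I from y to z}),
    Q (hclass p) (hclass q)) ->
  forall a b, tgt a = src b -> Q a b.
Proof.
move=> h; elim/Pi_ind => x y p b; rewrite tgt_hclass => /esym.
by move: b; apply: hclass_ind_from => z q.
Qed.

Lemma src_mul a b : tgt a = src b -> src (a ** b) = src a.
Proof. by move: a b; apply: Pi_ind2 => *; rewrite mul_hclass !src_hclass. Qed.

Lemma tgt_mul a b : tgt a = src b -> tgt (a ** b) = tgt b.
Proof. by move: a b; apply: Pi_ind2 => *; rewrite mul_hclass !tgt_hclass. Qed.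

Lemma mul_id_l a : Pi_id (src a) ** a = a.
Proof.
elim/Pi_ind: a => x y p; rewrite src_hclass mul_hclass.
by apply/esym/hclassP; exact: concat_cstl.
Qed.

Lemma mul_id_r a : a ** Pi_id (tgt a) = a.
Proof.
elim/Pi_ind: a => x y p; rewrite tgt_hclass mul_hclass.
by apply/esym/hclassP; exact: concat_cstr.
Qed.

Lemma mulA a b c : tgt a = src b -> tgt b = src c ->
  a ** (b ** c) = a ** b ** c.
Proof.
move: a b; apply: Pi_ind2 => x y z p q; rewrite tgt_hclass => /esym.
by move: c; apply: hclass_ind_from => w r; rewrite !mul_hclass hclassA.
Qed.

Lemma mul_inv_r a : a ** Pi_inv a = Pi_id (src a).
Proof.
elim/Pi_ind: a => x y p; rewrite inv_hclass mul_hclass src_hclass.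
exact/hclassP/concat_rev_path.
Qed.

Lemma inv_inv a : Pi_inv (Pi_inv a) = a.
Proof. by elim/Pi_ind: a => x y p; rewrite !inv_hclass rev_pathK. Qed.

Lemma mul_inv_l a : Pi_inv a ** a = Pi_id (tgt a).
Proof. by rewrite -{2}[a]inv_inv mul_inv_r src_inv. Qed.

Lemma mulKV a b : src a = src b -> a ** (Pi_inv a ** b) = b.
Proof. by move=> ab; rewrite mulA ?src_inv ?tgt_inv// mul_inv_r ab mul_id_l. Qed.

Lemma mulVK a b : tgt a = src b -> Pi_inv a ** (a ** b) = b.
Proof. by move=> ab; rewrite mulA ?src_inv ?tgt_inv// mul_inv_l ab mul_id_l. Qed.

Lemma mulKr a b : tgt a = src b -> a ** b ** Pi_inv b = a.
Proof. by move=> ab; rewrite -mulA ?src_inv// mul_inv_r -ab mul_id_r. Qed.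

Lemma mulKVr a b : tgt a = tgt b -> a ** Pi_inv b ** b = a.
Proof. by move=> ab; rewrite -{2}[b]inv_inv mulKr ?src_inv. Qed.

Lemma inv_mul a b : tgt a = src b -> Pi_inv (a ** b) = Pi_inv b ** Pi_inv a.
Proof.
move=> ab; rewrite -[RHS](@mulKr _ (a ** b)); last first.
  by rewrite tgt_mul ?src_mul ?tgt_inv ?src_inv.
have -> : Pi_inv b ** Pi_inv a ** (a ** b) = Pi_id (tgt b).
  by rewrite -mulA ?src_mul ?tgt_inv ?src_inv// mulVK// mul_inv_l.
by rewrite -(tgt_mul ab) -src_inv mul_id_l.
Qed.

(** For nice [U] these classes form the pair groupoid of [U]: one class for each pair of endpoints,
    by [nice_small] and [nice_small_eq]. *)
Definition small U a : Prop :=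
  exists x y (p : {path I from x to y}), range p `<=` U /\ a = hclass p.

Lemma small_src U a : small U a -> U (src a).
Proof.
move=> [x [y [p [pU ->]]]]; rewrite src_hclass.
by apply: pU; exists zero => //; rewrite path_zero.
Qed.

Lemma small_tgt U a : small U a -> U (tgt a).
Proof.
move=> [x [y [p [pU ->]]]]; rewrite tgt_hclass.
by apply: pU; exists one => //; rewrite path_one.
Qed.

Lemma small_id U x : U x -> small U (Pi_id x).
Proof. by move=> Ux; exists x, x, (cst x); split => // _ [t _ <-]. Qed.

Lemma small_inv U a : small U a -> small U (Pi_inv a).
Proof.
move=> [x [y [p [pU ->]]]]; exists y, x, (rev_path p).
by rewrite inv_hclass; split => //; exact: range_rev_path.
Qed.

Lemma small_mul U a b : tgt a = src b -> small U a -> small U b ->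
  small U (a ** b).
Proof.
move=> ab [x [y [p [pU aE]]]] [y' [z [q [qU bE]]]]; move: ab; rewrite {}aE {}bE.
rewrite tgt_hclass src_hclass => yE; subst y'; rewrite mul_hclass.
by exists x, z, (concat p q); split => //; exact: range_concat.
Qed.

Lemma smallW U V a : U `<=` V -> small U a -> small V a.
Proof.
move=> UV [x [y [p [pU ->]]]]; exists x, y, p; split => //.
exact: subset_trans UV.
Qed.

Lemma nice_small U x y : nice U -> U x -> U y ->
  exists a, [/\ small U a, src a = x & tgt a = y].
Proof.
move=> [_ pU _] Ux Uy; have [p rp] := pU x y Ux Uy.
by exists (hclass p); rewrite src_hclass tgt_hclass; split => //; exists x, y, p.
Qed.

Lemma nice_small_loop U a : nice U -> small U a -> src a = tgt a ->
  a = Pi_id (src a).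
Proof.
move=> [_ _ lU] sa; move: (sa) => [x [y [p [pU aE]]]].
move: sa; rewrite {}aE tgt_hclass src_hclass => /small_src.
rewrite src_hclass => Ux xy; subst y.
exact: lU.
Qed.

(** [a ** Pi_inv b] is a small loop, hence trivial. *)
Lemma nice_small_eq U a b : nice U -> small U a -> small U b ->
  src a = src b -> tgt a = tgt b -> a = b.
Proof.
move=> nU sa sb sab tab.
have := @nice_small_loop U (a ** Pi_inv b) nU.
rewrite src_mul ?src_inv// tgt_mul ?src_inv// tgt_inv => /(_ _ sab) e.
rewrite -(mulKVr tab) e ?sab ?mul_id_l//.
by apply: small_mul; rewrite ?src_inv//; exact: small_inv.
Qed.

(** The basic set S(U, V, a) in terms of the groupoid, without representatives of [a]; see
    [Pi_basicE]. *)
Definition Pi_nbhd U V a : set Pi :=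
  [set b | exists d1 d2, [/\ small U d1, small V d2, tgt d1 = src a,
    src d2 = tgt a & b = d1 ** a ** d2]].

Lemma Pi_basicE U V (x y : X) (p : {path I from x to y}) :
  Pi_basic U V p = Pi_nbhd U V (hclass p).
Proof.
apply/seteqP; split=> b.
  move=> [x' [y' [d1 [d2 [d1U d2V ->]]]]]; exists (hclass d1), (hclass d2).
  rewrite !mul_hclass !src_hclass !tgt_hclass; split=> //.
    by exists x', x, d1.
  by exists y, y', d2.
move=> [_ [_ [[x1 [y1 [d1 [d1U ->]]]] [x2 [y2 [d2 [d2V ->]]]]]]].
rewrite !src_hclass !tgt_hclass => yE xE ->; subst.
by exists x1, y2, d1, d2; rewrite !mul_hclass.
Qed.

Lemma src_nbhd U V a b : Pi_nbhd U V a b -> U (src b).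
Proof.
move=> [d1 [d2 [s1 s2 t1 t2 ->]]].
by rewrite !src_mul ?tgt_mul//; exact: small_src.
Qed.

Lemma tgt_nbhd U V a b : Pi_nbhd U V a b -> V (tgt b).
Proof.
move=> [d1 [d2 [s1 s2 t1 t2 ->]]].
by rewrite !tgt_mul//; exact: small_tgt.
Qed.

Lemma nbhd_self U V a : U (src a) -> V (tgt a) -> Pi_nbhd U V a a.
Proof.
move=> Ua Va; exists (Pi_id (src a)), (Pi_id (tgt a)).
rewrite src_id tgt_id mul_id_l mul_id_r; split => //; exact: small_id.
Qed.

(** Together with [nbhd_self] and [nbhd_sym] this makes [Pi_nbhd U V] an equivalence relation on the
    classes from [U] to [V], so two such sets for the same [U] and [V] coincide or are disjoint. *)
Lemma nbhd_trans U V a b : Pi_nbhd U V a b -> Pi_nbhd U V b `<=` Pi_nbhd U V a.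
Proof.
move=> [d1 [d2 [s1 s2 t1 t2 ->]]] c [e1 [e2 [u1 u2]]].
rewrite !src_mul ?tgt_mul// => v1 v2 ->.
exists (e1 ** d1), (d2 ** e2); split.
- exact: small_mul.
- exact: small_mul.
- by rewrite tgt_mul.
- by rewrite src_mul.
by rewrite !mulA ?src_mul ?tgt_mul// ?src_mul.
Qed.

Lemma nbhd_sym U V a b : Pi_nbhd U V a b -> Pi_nbhd U V b a.
Proof.
move=> [d1 [d2 [s1 s2 t1 t2 ->]]]; exists (Pi_inv d1), (Pi_inv d2).
rewrite !tgt_inv !src_inv !src_mul ?tgt_mul//; split => //;
  [exact: small_inv|exact: small_inv|].
by rewrite mulA ?tgt_inv ?tgt_mul ?src_mul// mulVK// mulKr.
Qed.

Lemma nbhdW U V U' V' a : U' `<=` U -> V' `<=` V ->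
  Pi_nbhd U' V' a `<=` Pi_nbhd U V a.
Proof.
move=> UU VV b [d1 [d2 [s1 s2 t1 t2 ->]]]; exists d1, d2; split => //.
  exact: smallW s1.
exact: smallW s2.
Qed.

(** Injectivity of the endpoint map on a basic set: by [nice_small_eq] each of the two short
    correcting factors is determined by its endpoints. Surjectivity onto [U] times [V] is
    [nbhd_ex]. *)
Lemma nbhd_uniq U V a b c : nice U -> nice V -> Pi_nbhd U V a b ->
  Pi_nbhd U V a c -> src b = src c -> tgt b = tgt c -> b = c.
Proof.
move=> nU nV [d1 [d2 [s1 s2 t1 t2 ->]]] [e1 [e2 [u1 u2 v1 v2 ->]]].
rewrite !src_mul ?tgt_mul// => sde tde.
rewrite (nice_small_eq nU s1 u1 sde) ?t1//.
by rewrite (nice_small_eq nV s2 u2 _ tde) ?t2.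
Qed.

Lemma nbhd_ex U V a x y : nice U -> nice V -> U (src a) -> V (tgt a) ->
  U x -> V y -> exists b, [/\ Pi_nbhd U V a b, src b = x & tgt b = y].
Proof.
move=> nU nV Ua Va Ux Vy.
have [d1 [s1 x1 t1]] := nice_small nU Ux Ua.
have [d2 [s2 x2 t2]] := nice_small nV Va Vy.
exists (d1 ** a ** d2).
rewrite !src_mul ?tgt_mul//; split => //.
by exists d1, d2.
Qed.

End Groupoid.
Arguments Pi_id {R X} x.

Local Notation "a ** b" := (Pi_mul a b) (at level 40, left associativity).

(** * The topology of Pi *)

Section General.

(** The local hypothesis makes both [Q] and its complement open. It serves for the real line in
    [Pi_path_ind] and for the space itself in [connected_Pi]. *)
Lemma connected_locally_constant (T : topologicalType) (Q : set T) :
  connected [set: T] -> (forall t, \forall s \near t, Q s <-> Q t) ->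
  forall x y, Q x -> Q y.
Proof.
move=> cT Qloc x y Qx; suff -> : Q = [set: T] by [].
have oQ : open Q.
  rewrite openE => t Qt; apply: filterS (Qloc t) => s.
  by case=> _; exact.
apply: cT; first by exists x.
  by exists Q => //; rewrite setTI.
exists Q; last by rewrite setTI.
rewrite -openC openE => t Qt; apply: filterS (Qloc t) => s.
by case=> st _ /st.
Qed.

Lemma second_countable_basis (T : topologicalType) (N : set (set T)) :
  @second_countable T -> basis N ->
  exists B, [/\ countable B, B `<=` N & basis B].
Proof.
move=> [C cC [oC bC]] [oN bN].
(* For each pair from the countable basis, one member of [N] squeezed between the two sets. When
   there is none, the default [set0] may fail to lie in [N], whence the clause [N W] in [B]. *)
pose h (UV : set T * set T) :=
  xget set0 [set W | [/\ N W, UV.1 `<=` W & W `<=` UV.2]].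
pose B := [set W | N W /\ (h @` (C `*` C)) W].
exists B; split.
- apply: sub_countable (countableX cC cC).
  apply: card_le_trans (card_image_le h _).
  by apply: subset_card_le => W [].
- by move=> W [].
split; first by move=> W [/oN].
move=> x O xO.
(* The chain [U], [W], [V], [O] is increasing; [W] shows that the pair [(U, V)] admits a choice. *)
have [V [CV Vx] VO] := bC x O xO.
have [W [NW Wx] WV] := bN x V (open_nbhs_nbhs (conj (oC _ CV) Vx)).
have [U [CU Ux] UW] := bC x W (open_nbhs_nbhs (conj (oN _ NW) Wx)).
have [Nh Uh hV] : [/\ N (h (U, V)), U `<=` h (U, V) & h (U, V) `<=` V].
  exact: (@xgetI _ set0
    [set W | [/\ N W, U `<=` W & W `<=` V]] W (And3 NW UW WV)).
exists (h (U, V)).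
  by split; [split => //; exists (U, V)|exact: Uh].
exact: subset_trans VO.
Qed.

End General.

(** * Induction along a path *)

Section PathInduction.
Context {R : realType} {X : topologicalType}.
Local Notation I := (unit_interval R).
Local Notation Pi := (Pi R X).

Lemma eq_hclass (x y x' y' : X) (p : {path I from x to y})
    (q : {path I from x' to y'}) : (forall t, p t = q t) -> hclass p = hclass q.
Proof.
move=> pq; have xE : x = x' by rewrite -(path_zero (s := p)) pq path_zero.
have yE : y = y' by rewrite -(path_one (s := p)) pq path_one.
by subst; congr hclass; exact/path_eqP.
Qed.

(** The set of [t] such that [Q] holds for the initial piece of the path up to time [t] is locally
    constant on the line and contains 0, hence contains 1. *)
Lemma Pi_path_ind (Q : Pi -> Prop) :
  (forall x, Q (Pi_id x)) ->
  (forall y, exists U : set X, [/\ open U, U y & forall a s, Q a ->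
    small U s -> Pi_tgt a = Pi_src s -> Q (a ** s)]) ->
  forall a, Q a.
Proof.
move=> Qid Qloc; apply: Pi_ind => x y p.
pose P : R -> X := p \o clip.
have cP : continuous P.
  move=> t; apply: continuous_comp; first exact: clip_continuous.
  exact: cts_fun.
suff : Q (hclass (arc cP 0 1)).
  congr Q; apply: eq_hclass => t.
  by rewrite arcE subr0 mul1r addr0 /P /= ivalK.
have Q0 : Q (hclass (arc cP 0 0)).
  rewrite (_ : hclass _ = Pi_id (P 0)) //; apply: eq_hclass => t.
  by rewrite arcE subrr mul0r add0r.
have cR : connected [set: R^o] by apply/connected_intervalP => ? ? ? ? ? ?.
move: Q0; apply: (@connected_locally_constant R^o
  (fun t => Q (hclass (arc cP 0 t))) cR _ 0 1) => t.
have [U [oU Ut stepU]] := Qloc (P t).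
have /nbhs_ballP[e /= e0 eU] : nbhs t (P @^-1` U).
  by apply: cP; exact: open_nbhs_nbhs.
(* The arc between two times of the ball stays in [U] because the ball is convex. The claim is
   symmetric in [s] and [s'], which gives both directions of local constancy. *)
have step s s' : ball t e s -> ball t e s' ->
    Q (hclass (arc cP 0 s)) -> Q (hclass (arc cP 0 s')).
  move=> bs bs' Qs; rewrite -(hclass_arc cP 0 s s') -mul_hclass.
  apply: stepU => //; last by rewrite tgt_hclass src_hclass.
  exists (P s), (P s'), (arc cP s s'); split => // _ [u _ <-].
  rewrite arcE; apply: eU.
  move: bs bs'; rewrite /ball /= !ltr_norml => /andP[h1 h2] /andP[h3 h4].
  have u0 := ival_ge0 u; have u1 := ival_le1 u.
  by case: (leP s s') => ss'; apply/andP; split; nra.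
apply/nbhs_ballP; exists e => //= s bs.
by split; apply: step => //; exact: ballxx.
Qed.

End PathInduction.

(** * Continuity of the groupoid operations and separation *)

Section PiTopology.
Context {R : realType} {X : topologicalType}.
Local Notation I := (unit_interval R).
Local Notation Pi := (Pi R X).
Local Notation nice := (@nice R X).
Local Notation src := (@Pi_src R X).
Local Notation tgt := (@Pi_tgt R X).
Implicit Types (a b c : Pi) (U V W : set X).
Hypothesis niceB : basis nice.

Lemma nice_nbhs (x : X) (O : set X) : nbhs x O ->
  exists U, [/\ nice U, U x & U `<=` O].
Proof. by move=> /(niceB.2 x)[U [nU Ux] UO]; exists U. Qed.

Lemma nice_nbhsx U (x : X) : nice U -> U x -> nbhs x U.
Proof. by move=> [oU _ _] Ux; exact: open_nbhs_nbhs. Qed.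

Lemma nbhd_open U V a : nice U -> nice V -> U (src a) -> V (tgt a) ->
  open (Pi_nbhd U V a).
Proof.
move: a; apply: Pi_ind => x y p nU nV; rewrite src_hclass tgt_hclass => Ux Vy.
by rewrite -Pi_basicE; apply: (Pi_base_basis niceB).1; exists U, V, x, y, p.
Qed.

Lemma nbhs_nbhd U V a : nice U -> nice V -> U (src a) -> V (tgt a) ->
  nbhs a (Pi_nbhd U V a).
Proof.
move=> nU nV Ua Va; apply: open_nbhs_nbhs; split; first exact: nbhd_open.
exact: nbhd_self.
Qed.

(** A basic set containing [a] may be recentered at [a] by [nbhd_trans]; then [U] and [V] can be
    shrunk into prescribed neighborhoods of the endpoints. *)
Lemma Pi_nbhsE a (O : set Pi) (U0 V0 : set X) : nbhs a O ->
  nbhs (src a) U0 -> nbhs (tgt a) V0 ->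
  exists U V, [/\ nice U, nice V, U (src a) /\ V (tgt a),
    U `<=` U0 /\ V `<=` V0 & Pi_nbhd U V a `<=` O].
Proof.
move=> aO aU0 aV0.
have [_ [[U [V [x [y [p [nU nV Ux Vy ->]]]]]] ap] pO] :=
  (Pi_base_basis niceB).2 a O aO.
rewrite Pi_basicE in ap pO.
have [U1 [nU1 U1a]] := nice_nbhs
  (filterI aU0 (nice_nbhsx nU (src_nbhd ap))).
rewrite subsetI => -[U10 U1U].
have [V1 [nV1 V1a]] := nice_nbhs
  (filterI aV0 (nice_nbhsx nV (tgt_nbhd ap))).
rewrite subsetI => -[V10 V1V].
exists U1, V1; split => //.
apply: subset_trans pO => b /(nbhdW U1U V1V).
exact: nbhd_trans.
Qed.

Lemma src_continuous : continuous src.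
Proof.
move=> a O aO; have [U [V [nU nV [Ua Va] [UO _] _]]] :=
  Pi_nbhsE (@filterT _ (nbhs a) _) aO (@filterT _ (nbhs (tgt a)) _).
apply: filterS (nbhs_nbhd nU nV Ua Va) => b ab.
exact: UO (src_nbhd ab).
Qed.

Lemma tgt_continuous : continuous tgt.
Proof.
move=> a O aO; have [U [V [nU nV [Ua Va] [_ VO] _]]] :=
  Pi_nbhsE (@filterT _ (nbhs a) _) (@filterT _ (nbhs (src a)) _) aO.
apply: filterS (nbhs_nbhd nU nV Ua Va) => b ab.
exact: VO (tgt_nbhd ab).
Qed.

Lemma mul_near a b (O : set Pi) : tgt a = src b -> nbhs (a ** b) O ->
  exists Oa Ob, [/\ nbhs a Oa, nbhs b Ob &
    forall a' b', Oa a' -> Ob b' -> tgt a' = src b' -> O (a' ** b')].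
Proof.
move=> ab abO.
have [U [V [nU nV [Ua Va] _ UVO]]] := Pi_nbhsE abO
  (@filterT _ (nbhs (src (a ** b))) _) (@filterT _ (nbhs (tgt (a ** b))) _).
rewrite src_mul// in Ua; rewrite tgt_mul// in Va.
have [W [nW Wa _]] := nice_nbhs (@filterT _ (nbhs (tgt a)) _).
exists (Pi_nbhd U W a), (Pi_nbhd W V b); split.
- exact: nbhs_nbhd.
- by apply: nbhs_nbhd => //; rewrite -ab.
move=> _ _ [d1 [d2 [s1 s2 t1 t2 ->]]] [d3 [d4 [s3 s4 t3 t4 ->]]].
rewrite !tgt_mul// !src_mul ?tgt_mul// => d23; apply: UVO.
exists d1, d4; rewrite src_mul// tgt_mul//; split => //.
(* The two correcting factors at the junction form a loop inside the nice set [W], so they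
   cancel. *)
have d23E : d2 ** d3 = Pi_id (tgt a).
  rewrite (@nice_small_loop _ _ W (d2 ** d3) nW); first by rewrite src_mul ?t2.
    exact: small_mul.
  by rewrite src_mul// tgt_mul// t2 t3.
rewrite (_ : d1 ** a ** d2 ** (d3 ** b ** d4) = d1 ** (a ** (d2 ** d3) ** b) ** d4).
  by rewrite d23E mul_id_r.
rewrite !(mulA, src_mul, tgt_mul)//.
Qed.

(** Inversion carries a basic set for [U] and [V] to one for [V] and [U]. *)
Lemma inv_continuous : continuous (@Pi_inv R X).
Proof.
move=> a O aO; have [V [U [nV nU [Va Ua] _ UVO]]] := Pi_nbhsE aO
  (@filterT _ (nbhs (src (Pi_inv a))) _) (@filterT _ (nbhs (tgt (Pi_inv a))) _).
rewrite src_inv in Va; rewrite tgt_inv in Ua.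
apply: filterS (nbhs_nbhd nU nV Ua Va) => _ [d1 [d2 [s1 s2 t1 t2 ->]]].
apply: UVO; exists (Pi_inv d2), (Pi_inv d1).
rewrite !inv_mul ?tgt_mul// !src_inv !tgt_inv; split => //.
- exact: small_inv.
- exact: small_inv.
- by rewrite mulA ?tgt_inv ?src_inv.
Qed.

(* [(src, tgt)] is injective on [Pi_nbhd U V a], so a map into this set is
   continuous as soon as its endpoints vary continuously. *)
Lemma lift_continuous (T : topologicalType) (h : T -> Pi) (t : T) U V a :
  nice U -> nice V -> (\forall s \near t, Pi_nbhd U V a (h s)) ->
  {for t, continuous (src \o h)} -> {for t, continuous (tgt \o h)} ->
  {for t, continuous h}.
Proof.
move=> nU nV hUV sh th O ntO; have ht := nbhs_singleton hUV.
have [U1 [V1 [nU1 nV1 [U1h V1h] [U1U V1V] UVO]]] := Pi_nbhsE ntO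
  (nice_nbhsx nU (src_nbhd ht)) (nice_nbhsx nV (tgt_nbhd ht)).
have sU1 : \forall s \near t, U1 (src (h s)).
  exact: sh (nice_nbhsx nU1 U1h).
have tV1 : \forall s \near t, V1 (tgt (h s)).
  exact: th (nice_nbhsx nV1 V1h).
apply: filterS (filterI hUV (filterI sU1 tV1)) => s [hs [U1s V1s]]; apply: UVO.
(* The class near [h t] with the endpoints of [h s] must be [h s], by uniqueness in the larger basic
   set. *)
have [b [bh sb tb]] := nbhd_ex nU1 nV1 U1h V1h U1s V1s.
rewrite -(nbhd_uniq nU nV _ hs sb tb)//.
apply: (nbhd_trans ht); exact: nbhdW bh.
Qed.

(** Classes with different endpoints are separated by preimages from [X]. If the endpoints agree,
    basic sets for the same [U] and [V] are disjoint: a common point [c] would have both classes in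
    its own basic set, against [nbhd_uniq]. *)
Lemma Pi_hausdorff : hausdorff_space X -> hausdorff_space Pi.
Proof.
rewrite !open_hausdorff => hX a b ab.
have sep (f : Pi -> X) : continuous f -> f a != f b ->
    exists2 AB : set Pi * set Pi, (a \in AB.1 /\ b \in AB.2) &
      [/\ open AB.1, open AB.2 & AB.1 `&` AB.2 == set0].
  move=> cf /hX[[A B]/= [aA bB] [oA oB AB]].
  exists (f @^-1` A, f @^-1` B) => /=.
    by rewrite !inE in aA bB *.
  split; [by apply: open_comp => // ? _; exact: cf..|].
  by rewrite -preimage_setI (eqP AB) preimage_set0.
have [sab|/sep] := eqVneq (src a) (src b); last by apply; exact: src_continuous.
have [tab|/sep] := eqVneq (tgt a) (tgt b); last by apply; exact: tgt_continuous.
have [U [nU Ua _]] := nice_nbhs (@filterT _ (nbhs (src a)) _).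
have [V [nV Va _]] := nice_nbhs (@filterT _ (nbhs (tgt a)) _).
exists (Pi_nbhd U V a, Pi_nbhd U V b) => /=.
  by rewrite !inE; split; apply: nbhd_self; rewrite -?sab -?tab.
split; [by apply: nbhd_open; rewrite -?sab -?tab..|].
apply/eqP/seteqP; split => // c [ac bc].
move/eqP: ab; apply; have ca := nbhd_sym ac; have cb := nbhd_sym bc.
exact: nbhd_uniq nU nV ca cb sab tab.
Qed.

End PiTopology.

(** * Second countability *)

Section PiSecondCountable.
Context {R : realType} {X : topologicalType}.
Local Notation I := (unit_interval R).
Local Notation Pi := (Pi R X).
Local Notation nice := (@nice R X).
Local Notation src := (@Pi_src R X).
Local Notation tgt := (@Pi_tgt R X).
Implicit Types (a b c : Pi) (U V W : set X).
Hypothesis niceB : basis nice.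
Variables (x0 : X) (B : set (set X)).
Hypotheses (cB : countable B) (Bnice : B `<=` nice) (bB : basis B).

Let ctr (U : set X) : X := xget x0 U.

Let ctrP U x : U x -> U (ctr U).
Proof. exact: xgetI. Qed.

(** A class inside the first set joining the chosen points of the other two. For a nice first set
    containing both points it is the only such class. *)
Let link (UVW : set X * set X * set X) : Pi := xget (Pi_id x0)
  [set a | [/\ small UVW.1.1 a, src a = ctr UVW.1.2 & tgt a = ctr UVW.2]].

Let linkP U V W : nice U -> U (ctr V) -> U (ctr W) ->
  [/\ small U (link (U, V, W)), src (link (U, V, W)) = ctr V &
      tgt (link (U, V, W)) = ctr W].
Proof.
move=> nU UV UW; rewrite /link /=.
exact: (@xgetPex _ (Pi_id x0)
  [set a | [/\ small U a, src a = ctr V & tgt a = ctr W]] (nice_small nU UV UW)).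
Qed.

Let links : set Pi := link @` (B `*` B `*` B).

Let links_countable : countable links.
Proof.
apply: sub_countable (countableX (countableX cB cB) cB).
exact: card_image_le.
Qed.

Let Fixpoint chain (k : nat) : set Pi :=
  if k is k'.+1 then (fun gs => gs.1 ** gs.2) @` (chain k' `*` links)
  else (Pi_id \o ctr) @` B.

Let chains : set Pi := \bigcup_k chain k.

Let chains_countable : countable chains.
Proof.
apply: bigcup_countable => // k _; elim: k => [|k IH] /=.
  exact: sub_countable (card_image_le _ _) cB.
apply: sub_countable (countableX IH links_countable).
exact: card_image_le.
Qed.

Let chains_id U : B U -> chains (Pi_id (ctr U)).
Proof. by move=> BU; exists 0%N => //; exists U. Qed.

Let chains_mul g s : chains g -> links s -> chains (g ** s).
Proof. by move=> [k _ gk] ls; exists k.+1 => //; exists (g, s). Qed.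

(** With a basic set [W] inside both [U] and [V] around the end of [r], the detour goes from the
    center of [U] to that of [W] inside [U], then to that of [V] inside [V], and back through [W] to
    the end of [r]. After cancellation both sides are classes in [U] with equal endpoints. *)
Let relink U V r : B U -> B V -> small U r -> src r = ctr U -> V (tgt r) ->
  exists s1 s2 d, [/\ links s1 /\ links s2, tgt s1 = src s2,
    src s1 = ctr U /\ tgt s2 = ctr V, small V d /\ src d = ctr V &
    r = s1 ** s2 ** d].
Proof.
move=> BU BV sr srcr Vr; have nU := Bnice BU; have nV := Bnice BV.
have Ur := small_tgt sr.
have [W [BW Wr]] := bB.2 _ _ (filterI (nice_nbhsx nU Ur) (nice_nbhsx nV Vr)).
rewrite subsetI => -[WU WV]; have Wc := ctrP Wr.
have [s1 src1 tgt1] := linkP nU (ctrP Ur) (WU _ Wc).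
have [s2 src2 tgt2] := linkP nV (WV _ Wc) (ctrP Vr).
have [w [sw srcw tgtw]] := nice_small (Bnice BW) Wc Wr.
set l1 := link (U, U, W) in s1 src1 tgt1; set l2 := link (V, W, V) in s2 src2 tgt2.
have l12 : tgt l1 = src l2 by rewrite tgt1 src2.
have l2w : tgt (Pi_inv l2) = src w by rewrite tgt_inv src2.
exists l1, l2, (Pi_inv l2 ** w).
have l2w' : tgt l2 = src (Pi_inv l2 ** w) by rewrite src_mul ?src_inv.
split => //.
- by split; [exists (U, U, W)|exists (V, W, V)].
- split; last by rewrite -l2w'.
  by apply: small_mul => //; [exact: small_inv|exact: smallW sw].
- rewrite -mulA// mulKV ?src2//.
  apply: (nice_small_eq nU sr).
  + by apply: small_mul; [rewrite tgt1|exact: s1|exact: smallW sw].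
  + by rewrite src_mul ?tgt1// src1.
  + by rewrite tgt_mul ?tgt1.
Qed.

(** Path induction on [a], with [U] and [V] universally quantified: the step applies the hypothesis
    to a different target set. *)
Let chain_nbhd a U V : B U -> B V -> U (src a) -> V (tgt a) ->
  exists g, [/\ chains g, Pi_nbhd U V g a, src g = ctr U & tgt g = ctr V].
Proof.
move: a U V; apply: Pi_path_ind => [x U V|y].
  rewrite src_id tgt_id => BU BV Ux Vx.
  have [r [sr srcr tgtr]] := nice_small (Bnice BU) (ctrP Ux) Ux.
  rewrite -tgtr in Vx.
  (* The identity at [x] is [Pi_inv r ** r]; relinking [r] towards [V] turns it into a chain with
     short ends. *)
  have [s1 [s2 [d [[l1 l2] s12 [srcs1 tgts2] [sd srcd] rE]]]] :=
    relink BU BV sr srcr Vx.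
  have cs1 : tgt (Pi_id (ctr U)) = src s1 by rewrite tgt_id.
  have gE : Pi_id (ctr U) ** s1 = s1 by rewrite -srcs1 mul_id_l.
  have rs : tgt (Pi_inv r) = src (s1 ** s2) by rewrite tgt_inv srcr src_mul.
  exists (Pi_id (ctr U) ** s1 ** s2); rewrite gE src_mul// tgt_mul//; split => //.
    by rewrite -gE; do 2 apply: chains_mul => //; exact: chains_id.
  exists (Pi_inv r), d; rewrite src_mul// tgt_mul// tgt_inv srcr; split => //.
  - exact: small_inv.
  - by rewrite srcd.
  - rewrite -mulA ?tgt_mul ?srcd// -rE -{2}[r]inv_inv mul_inv_r src_inv.
    by rewrite tgtr.
have [W [BW Wy _]] := bB.2 _ _ (@filterT _ (nbhs y) _).
exists W; split => //; first by have [] := Bnice BW.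
move=> a s IH ss as_ U V BU BV; rewrite src_mul// tgt_mul// => Ua Vs.
have Wa : W (tgt a) by rewrite as_; exact: small_src.
have [g [cg [d1 [d2 [sd1 sd2 t1 t2 aE]]] srcg tgtg]] := IH U W BU BW Ua Wa.
have d2s : tgt d2 = src s by rewrite -as_ aE tgt_mul// tgt_mul.
(* The end [d2] left over by the chain for [a], followed by the new piece [s], is still small in [W]
   and starts at its center, so it can be relinked towards [V]. *)
have [||s1 [s2 [d [[l1 l2] s12 [srcs1 tgts2] [sd srcd] dE]]]] :=
  @relink W V (d2 ** s) BW BV (small_mul d2s sd2 ss).
- by rewrite src_mul// t2.
- by rewrite tgt_mul.
have gs1 : tgt g = src s1 by rewrite tgtg.
have gs2 : tgt (g ** s1) = src s2 by rewrite tgt_mul.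
exists (g ** s1 ** s2); split.
- by do 2 apply: chains_mul => //.
- exists d1, d; rewrite !src_mul// tgt_mul//; split => //.
    by rewrite srcd.
  rewrite aE -mulA ?tgt_mul// dE.
  rewrite !(mulA, src_mul, tgt_mul)// ?srcd//.
- by rewrite !src_mul.
- by rewrite tgt_mul.
Qed.

Lemma Pi_second_countable_basis : @second_countable Pi.
Proof.
pose h (x : set X * set X * Pi) := Pi_nbhd x.1.1 x.1.2 x.2.
exists [set S | open S /\ (h @` (B `*` B `*` chains)) S].
  apply: sub_countable (countableX (countableX cB cB) chains_countable).
  apply: card_le_trans (card_image_le h _).
  by apply: subset_card_le => S [].
split; first by move=> S [].
move=> a O aO.
have [U' [V' [nU' nV' [Ua Va] _ UVO]]] := Pi_nbhsE niceB aO
  (@filterT _ (nbhs (src a)) _) (@filterT _ (nbhs (tgt a)) _).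
have [U [BU Ua'] UU] := bB.2 _ _ (nice_nbhsx nU' Ua).
have [V [BV Va'] VV] := bB.2 _ _ (nice_nbhsx nV' Va).
have [g [cg ga srcg tgtg]] := chain_nbhd BU BV Ua' Va'.
exists (Pi_nbhd U V g).
  split => //; split; last by exists (U, V, g).
  apply: nbhd_open => //; [exact: Bnice|exact: Bnice| |].
    by rewrite srcg; exact: ctrP Ua'.
  by rewrite tgtg; exact: ctrP Va'.
(* As [a] lies in the basic set around the chain [g], symmetry and transitivity place that whole set
   inside the one around [a]. *)
apply: subset_trans UVO; apply: subset_trans (nbhdW UU VV).
exact/nbhd_trans/nbhd_sym.
Qed.

End PiSecondCountable.

Section Consequences.
Context {R : realType} {X : topologicalType}.
Hypothesis niceB : basis (@nice R X).

Lemma Pi_second_countable : @second_countable X ->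
  @second_countable (Pi R X).
Proof.
move=> /second_countable_basis/(_ niceB)[B [cB nB bB]].
(* The choice of centers needs a default point; if [X] is empty, so is [Pi]. *)
have [[x0 _]|X0] := pselect (exists x0 : X, True); last first.
  exists set0; first exact: countable0.
  by split=> // a; case: X0; exists (Pi_src a).
exact: (@Pi_second_countable_basis _ _ niceB x0 B) => //.
Qed.

(** The endpoints reachable from [x] form a locally constant set, since nice sets are path
    connected. *)
Lemma connected_Pi (x y : X) : connected [set: X] ->
  exists a : Pi R X, Pi_src a = x /\ Pi_tgt a = y.
Proof.
move=> cX; have Qx : exists a : Pi R X, Pi_src a = x /\ Pi_tgt a = x.
  by exists (Pi_id x); rewrite src_id tgt_id.
move: Qx; apply: (@connected_locally_constant X
  (fun y => exists a : Pi R X, Pi_src a = x /\ Pi_tgt a = y) cX) => {}y.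
have [U [nU Uy _]] := nice_nbhs niceB (@filterT _ (nbhs y) _).
have ext z z' : U z -> U z' -> (exists a : Pi R X, Pi_src a = x /\ Pi_tgt a = z) ->
    exists a : Pi R X, Pi_src a = x /\ Pi_tgt a = z'.
  move=> Uz Uz' [a [ax az]]; have [s [_ sz sz']] := nice_small nU Uz Uz'.
  by exists (a ** s); rewrite src_mul ?tgt_mul ?sz.
apply: filterS (nice_nbhsx nU Uy) => z Uz.
by split; exact: ext.
Qed.

End Consequences.

(** * Nice open sets of a manifold *)

Section ManifoldNice.
Context {R : realType} {n : nat} {M : topologicalType}.
Local Notation I := (unit_interval R).
Implicit Type c : chart R n M.

Lemma ball_convex (v0 v w : 'rV[R]_n) (e s : R) : 0 <= s <= 1 ->
  ball v0 e v -> ball v0 e w -> ball v0 e ((1 - s) *: v + s *: w).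
Proof.
move=> /andP[s0 s1] [e0 bv] [_ bw]; split => // i j; rewrite !mxE.
move: (bv i j) (bw i j); rewrite /ball /= !ltr_norml => /andP[h1 h2] /andP[h3 h4].
by case: (leP (v i j) (w i j)) => vw; apply/andP; split; nra.
Qed.

Lemma segment_continuous (V : normedModType R) (v w : V) :
  continuous (fun t : I => (1 - ival t) *: v + ival t *: w).
Proof.
move=> t; apply: (continuous_comp (f := ival)
  (g := fun r => (1 - r) *: v + r *: w)); first exact: ival_continuous.
apply: cvgD; apply: cvgZr_tmp; last exact: cvg_id.
by apply: cvgB; [exact: cvg_cst|exact: cvg_id].
Qed.

Lemma chart_comp_continuous (T : topologicalType) c (f : T -> 'rV[R]_n) (t : T) :
  chart_cod c (f t) -> {for t, continuous f} ->
  {for t, continuous (chart_inv c \o f)}.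
Proof.
by move=> ct cf; apply: continuous_comp => //; exact: chart_inv_cts.
Qed.

(** Balls in coordinates are convex: segments join points, and the straight-line homotopy contracts
    a loop to its base point. *)
Lemma chart_ball_nice c (x : M) (e : R) : 0 < e -> chart_dom c x ->
  ball (chart_map c x) e `<=` chart_cod c ->
  nice (R := R) (chart_dom c `&` chart_map c @^-1` ball (chart_map c x) e).
Proof.
move=> e0 cx ecod; set b := ball _ _ in ecod *; set U := _ `&` _.
have Uinv v : b v -> U (chart_inv c v).
  move=> bv; have cv := ecod _ bv; split; first exact: chart_invP.
  by rewrite /= chart_invK.
have cmap (y z : M) (p : {path I from y to z}) : range p `<=` U ->
    continuous (chart_map c \o p).
  move=> pU t; apply: continuous_comp; first exact: cts_fun.
  by apply: chart_map_cts; have [] : U (p t) by apply: pU; exists t.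
split.
- rewrite openE => y [cy yb].
  apply: filterI; first exact: open_nbhs_nbhs (conj (chart_dom_open c) cy).
  apply: (chart_map_cts cy); apply: open_nbhs_nbhs; split => //.
  exact: ball_open.
- move=> y z [cy yb] [cz zb].
  pose f (t : I) := (1 - ival t) *: chart_map c y + ival t *: chart_map c z.
  have fb t : b (f t) by apply: ball_convex => //; rewrite ival_ge0 ival_le1.
  have cf : continuous f.
    exact: segment_continuous.
  have cg : continuous (chart_inv c \o f).
    by move=> t; apply: chart_comp_continuous; [exact: ecod|exact: cf].
  have g0 : (chart_inv c \o f) zero = y.
    by rewrite /= /f ival0 subr0 scale1r scale0r addr0 chart_mapK.
  have g1 : (chart_inv c \o f) one = z.
    by rewrite /= /f ival1 subrr scale0r scale1r add0r chart_mapK.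
  exists (mk_path cg g0 g1) => _ [t _ <-]; exact/Uinv/fb.
- move=> y p [cy yb] pU; apply/hclassP.
  have pdom t : U (p t) by apply: pU; exists t.
  apply: (@homotopic_factor _ _ _ (chart_inv c) (chart_map c \o p)
    (cst (chart_map c y))).
  + exact: cmap pU.
  + exact: cst_continuous.
  + move=> s t; apply: chart_inv_cts; apply: ecod; apply: ball_convex => //.
      by rewrite ival_ge0 ival_le1.
    by have [] := pdom t.
  + by rewrite /= path_zero.
  + by rewrite /= path_one.
  + by move=> t; rewrite /= chart_mapK//; have [] := pdom t.
  + by move=> t; rewrite /= chart_mapK.
Qed.

Lemma nice_basis (A : set (chart R n M)) :
  (forall x, exists2 c, A c & chart_dom c x) -> basis (@nice R M).
Proof.
move=> Acov; split; first by move=> U [].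
move=> x O xO; have [c _ cx] := Acov x.
have /nbhs_ballP[e1 /= e10 e1c] : nbhs (chart_map c x) (chart_cod c).
  apply: open_nbhs_nbhs; split; [exact: chart_cod_open|exact: chart_mapP].
have invO : nbhs (chart_map c x) (chart_inv c @^-1` O).
  apply: (chart_inv_cts (chart_mapP cx)); by rewrite chart_mapK.
have /nbhs_ballP[e2 /= e20 e2O] := invO.
(* Radius [e1] keeps the ball in the codomain of the chart, radius [e2] keeps its image in [O]. *)
pose e := Num.min e1 e2.
have e0 : 0 < e by rewrite lt_min e10.
have ball1 : ball (chart_map c x) e `<=` ball (chart_map c x) e1.
  by apply: le_ball; rewrite ge_min lexx.
have ball2 : ball (chart_map c x) e `<=` ball (chart_map c x) e2.
  by apply: le_ball; rewrite ge_min lexx orbT.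
exists (chart_dom c `&` chart_map c @^-1` ball (chart_map c x) e).
  split; last by split => //; exact: ballxx.
  by apply: chart_ball_nice => //; exact: subset_trans e1c.
by move=> y [cy /ball2/e2O]; rewrite /= chart_mapK.
Qed.

End ManifoldNice.

(** * Smooth maps between Euclidean spaces *)

Lemma near_eq_continuous (S T : topologicalType) (f g : S -> T) (x : S) :
  (\forall y \near x, f y = g y) -> {for x, continuous f} ->
  {for x, continuous g}.
Proof.
move=> fg cf O; rewrite -(nbhs_singleton fg) => /cf fO.
by apply: filterS (filterI fg fO) => y [/= <-].
Qed.

Section SmoothCalculus.
Context {R : realType}.

Section Locality.
Context {m k : nat}.
Implicit Types (U V : set 'rV[R]_m) (f g : 'rV[R]_m -> 'rV[R]_k).

Lemma Cr_sub r U V f : V `<=` U -> Cr r U f -> Cr r V f.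
Proof.
move=> VU; elim: r f => [|r IH] f [cf df]; (split; first by move=> x /VU/cf).
  exact: Logic.I.
by move=> i; have [d1 d2] := df i; split; [move=> x /VU/d1|exact: IH].
Qed.

(** Since [U] is open, agreement on [U] is agreement near each of its points, which passes to the
    partial derivatives. *)
Lemma eq_Cr r U f g : open U -> (forall x, U x -> f x = g x) ->
  Cr r U f -> Cr r U g.
Proof.
move=> oU; elim: r f g => [|r IH] f g fg [cf df];
  have near_fg x : U x -> \forall y \near x, f y = g y
    by move=> Ux; apply: filterS (open_nbhs_nbhs (conj oU Ux)).
  by split=> [x Ux|]; [apply: near_eq_continuous (cf _ Ux); exact: near_fg|].
split; first by move=> x Ux; apply: near_eq_continuous (cf _ Ux); exact: near_fg.
move=> i; have [d1 d2] := df i; split.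
  by move=> x Ux; apply: near_eq_derivable (near_fg _ Ux) (d1 _ Ux).
by apply: IH d2 => x Ux; apply: near_eq_derive; exact: near_fg.
Qed.

Lemma Cr_cst r U (a : 'rV[R]_k) : Cr r U (cst a).
Proof.
elim: r a => [|r IH] a; (split; first by move=> x _; exact: cst_continuous).
  exact: Logic.I.
move=> i; split; first by move=> x _; exact: derivable_cst.
rewrite (_ : 'D_(delta_mx 0 i) (cst a) = cst 0) //.
by apply/funext => x; rewrite derive_cst.
Qed.

End Locality.

(** Since [L] sends each basis vector to 0 or to a basis vector, each partial derivative of [f \o L]
    is 0 or a partial derivative of [f] after [L], so the induction goes through. *)
Lemma Cr_comp_linear (m m' k r : nat) (L : {linear 'rV[R]_m' -> 'rV[R]_m})
    (U : set 'rV[R]_m) (f : 'rV[R]_m -> 'rV[R]_k) :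
  continuous L ->
  (forall i, L (delta_mx 0 i) = 0 \/ exists j, L (delta_mx 0 i) = delta_mx 0 j) ->
  Cr r U f -> Cr r (L @^-1` U) (f \o L).
Proof.
move=> cL Ldelta; elim: r f => [|r IH] f [cf df];
  (split; first by move=> x Ux; apply: continuous_comp; [exact: cL|exact: cf]).
  exact: Logic.I.
move=> i.
have quotE x : (fun h : R => h^-1 *: ((f \o L \o shift x) (h *: delta_mx 0 i) - (f \o L) x))
    = (fun h => h^-1 *: ((f \o shift (L x)) (h *: L (delta_mx 0 i)) - f (L x))).
  by apply/funext => h /=; rewrite [L (_ + _)]linearD [L (_ *: _)]linearZ_LR.
have DE : 'D_(delta_mx 0 i) (f \o L) = 'D_(L (delta_mx 0 i)) f \o L.
  by apply/funext => x; rewrite /derive quotE.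
split.
  move=> x Ux; rewrite /derivable quotE.
  case: (Ldelta i) => [->|[j ->]]; first exact: derivable0.
  exact: (df j).1.
rewrite DE; case: (Ldelta i) => [->|[j ->]]; last exact: IH (df j).2.
rewrite (_ : _ \o _ = cst 0); first exact: Cr_cst.
by apply/funext => x /=; rewrite derive0.
Qed.

Lemma row_mx_continuous_at (T : topologicalType) (k1 k2 : nat)
    (f : T -> 'rV[R]_k1) (g : T -> 'rV[R]_k2) (x : T) :
  {for x, continuous f} -> {for x, continuous g} ->
  {for x, continuous (fun x => row_mx (f x) (g x))}.
Proof.
move=> cf cg B /nbhs_ballP[e e0 eB].
have nf : \forall y \near x, ball (f x) e (f y) by exact: cf (nbhsx_ballx _ _ e0).
have ng : \forall y \near x, ball (g x) e (g y) by exact: cg (nbhsx_ballx _ _ e0).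
apply: filterS (filterI nf ng) => y [/= fy gy]; apply: eB; split=> // i j; rewrite !mxE.
by case: (fintype.split j) => j'; [exact: fy.2|exact: gy.2].
Qed.

Lemma Cr_row_mx (m k1 k2 r : nat) (U : set 'rV[R]_m)
    (f : 'rV[R]_m -> 'rV[R]_k1) (g : 'rV[R]_m -> 'rV[R]_k2) :
  open U -> Cr r U f -> Cr r U g -> Cr r U (fun v => row_mx (f v) (g v)).
Proof.
move=> oU; elim: r f g => [|r IH] f g [cf df] [cg dg];
  (split; first by move=> x Ux; apply: row_mx_continuous_at; [exact: cf|exact: cg]).
  exact: Logic.I.
move=> i.
(* Each entry of the joined row is an entry of [f] or of [g], so derivatives can be computed
   entrywise. *)
have entryE (a : 'I_1) (b : 'I_(k1 + k2)) :
    (exists j, (fun v => row_mx (f v) (g v) a b) = (fun v => f v a j)) \/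
    (exists j, (fun v => row_mx (f v) (g v) a b) = (fun v => g v a j)).
  rewrite -[b]splitK; case: (fintype.split b) => j; [left|right]; exists j;
    by apply/funext => v; rewrite ?row_mxEl ?row_mxEr.
have dfg x : U x -> derivable (fun v => row_mx (f v) (g v)) x (delta_mx 0 i).
  move=> Ux; apply/derivable_mxP => a b.
  have /derivable_mxP fx := (df i).1 _ Ux.
  have /derivable_mxP gx := (dg i).1 _ Ux.
  by case: (entryE a b) => -[j ->]; [exact: fx|exact: gx].
split; first exact: dfg.
have := IH _ _ (df i).2 (dg i).2; apply: eq_Cr => // x Ux.
rewrite [RHS]derive_mx; last exact: dfg.
rewrite [X in row_mx X]derive_mx; last exact: (df i).1.
rewrite [X in row_mx _ X]derive_mx; last exact: (dg i).1.
apply/rowP => b; rewrite [RHS]mxE.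
rewrite -[b]splitK; case: (fintype.split b) => j.
  rewrite row_mxEl mxE; congr (derive _ x (delta_mx 0 i)); apply/funext => v.
  by rewrite row_mxEl.
rewrite row_mxEr mxE; congr (derive _ x (delta_mx 0 i)); apply/funext => v.
by rewrite row_mxEr.
Qed.

Lemma lsubmx_continuous (k1 k2 : nat) :
  continuous (fun v : 'rV[R]_(k1 + k2) => lsubmx v).
Proof.
move=> v B /nbhs_ballP[e e0 eB]; apply/nbhs_ballP; exists e => // w vw.
by apply: eB; split=> // i j; rewrite !mxE; exact: vw.2.
Qed.

Lemma rsubmx_continuous (k1 k2 : nat) :
  continuous (fun v : 'rV[R]_(k1 + k2) => rsubmx v).
Proof.
move=> v B /nbhs_ballP[e e0 eB]; apply/nbhs_ballP; exists e => // w vw.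
by apply: eB; split=> // i j; rewrite !mxE; exact: vw.2.
Qed.

Lemma Cr_comp_lsubmx (k1 k2 k r : nat) (U : set 'rV[R]_k1)
    (f : 'rV[R]_k1 -> 'rV[R]_k) : Cr r U f ->
  Cr r [set v : 'rV[R]_(k1 + k2) | U (lsubmx v)] (fun v => f (lsubmx v)).
Proof.
apply: (@Cr_comp_linear k1 (k1 + k2) k r lsubmx U f).
  exact: lsubmx_continuous.
move=> i; rewrite -[i]splitK; case: (fintype.split i) => j;
  [right; exists j|left]; by apply/rowP => l; rewrite !mxE eq_shift ?andbF.
Qed.

Lemma Cr_comp_rsubmx (k1 k2 k r : nat) (U : set 'rV[R]_k2)
    (f : 'rV[R]_k2 -> 'rV[R]_k) : Cr r U f ->
  Cr r [set v : 'rV[R]_(k1 + k2) | U (rsubmx v)] (fun v => f (rsubmx v)).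
Proof.
apply: (@Cr_comp_linear k2 (k1 + k2) k r rsubmx U f).
  exact: rsubmx_continuous.
move=> i; rewrite -[i]splitK; case: (fintype.split i) => j;
  [left|right; exists j]; by apply/rowP => l; rewrite !mxE eq_shift ?andbF.
Qed.

End SmoothCalculus.

(** * Charts and local trivializations *)

Section Subtype.
Context {X : topologicalType} {D : set X}.

Lemma set_val_continuous : continuous (set_val : D -> X).
Proof. exact: initial_continuous. Qed.

Lemma subtype_continuous_at (T : topologicalType) (h : T -> D) (t : T) :
  {for t, continuous (set_val \o h)} -> {for t, continuous h}.
Proof.
move=> ch O [_ [[W oW <-] /= Wt WO]].
have : \forall s \near t, W (set_val (h s)).
  by apply: ch; exact: open_nbhs_nbhs.
by apply: filterS => s; exact: WO.
Qed.

Lemma subtype_hausdorff : hausdorff_space X -> hausdorff_space D.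
Proof.
rewrite !open_hausdorff => hX x y xy.
have [|[P Q]/= [xP yQ] [oP oQ PQ]] := hX (set_val x) (set_val y).
  by apply: contra_neq xy => /val_inj.
exists (set_val @^-1` P, set_val @^-1` Q) => /=.
  by rewrite !inE in xP yQ *.
split; [by apply: open_comp => // ? _; exact: set_val_continuous..|].
by rewrite -preimage_setI (eqP PQ) preimage_set0.
Qed.

Lemma subtype_second_countable : @second_countable X -> @second_countable D.
Proof.
move=> [B cB [oB bB]]; exists (preimage set_val @` B).
  exact: sub_countable (card_image_le _ _) cB.
split.
  move=> _ [U BU <-]; apply: open_comp; last exact: oB.
  by move=> ? _; exact: set_val_continuous.
move=> x O [_ [[W oW <-] /= Wx WO]].
have [U [BU Ux] UW] := bB _ _ (open_nbhs_nbhs (conj oW Wx)).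
exists (set_val @^-1` U); first by split => //; exists U.
by apply: subset_trans WO => y; exact: UW.
Qed.

End Subtype.

Lemma pair_continuous_at (T U V : topologicalType) (f : T -> U) (g : T -> V)
    (t : T) :
  {for t, continuous f} -> {for t, continuous g} ->
  {for t, continuous (fun s => (f s, g s))}.
Proof. by move=> cf cg; apply: cvg_pair; [exact: cf|exact: cg]. Qed.

Lemma open_chart_preimage (R : realType) (n : nat) (T : topologicalType)
    (c : chart R n T) (D : set T) :
  open D -> open (chart_cod c `&` chart_inv c @^-1` D).
Proof.
move=> oD; rewrite openE => v [cv Dv]; apply: filterI.
  by apply: open_nbhs_nbhs; split; first exact: chart_cod_open.
by apply: chart_inv_cts => //; exact: open_nbhs_nbhs.
Qed.

Lemma open_smooth_dom (R : realType) (m n : nat) (S T : topologicalType)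
    (c : chart R m S) (d : chart R n T) (W : set S) (f : S -> T) :
  open W -> (forall x, W x -> {for x, continuous f}) ->
  open (chart_cod c `&`
    chart_inv c @^-1` (W `&` chart_dom c `&` f @^-1` chart_dom d)).
Proof.
move=> oW cf; apply: open_chart_preimage.
rewrite openE => x [[Wx cx] dfx]; apply: filterI.
  by apply: open_nbhs_nbhs; split => //; apply: openI => //; exact: chart_dom_open.
by apply: (cf _ Wx); exact: open_nbhs_nbhs (conj (chart_dom_open d) dfx).
Qed.

(** * Local inverses of the endpoint map *)

Section Lift.
Context {R : realType} {X : topologicalType}.
Local Notation Pi := (Pi R X).
Local Notation nice := (@nice R X).
Local Notation src := (@Pi_src R X).
Local Notation tgt := (@Pi_tgt R X).
Hypothesis niceB : basis nice.

(** The inverse of the endpoint map on the basic set around [a], defaulting to [a] where no class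
    fits. *)
Definition Pi_lift (U V : set X) (a : Pi) (x y : X) : Pi :=
  xget a [set b | [/\ Pi_nbhd U V a b, src b = x & tgt b = y]].

Lemma Pi_liftP U V a x y : nice U -> nice V -> U (src a) -> V (tgt a) ->
  U x -> V y -> [/\ Pi_nbhd U V a (Pi_lift U V a x y),
    src (Pi_lift U V a x y) = x & tgt (Pi_lift U V a x y) = y].
Proof.
move=> nU nV Ua Va Ux Vy.
exact: (@xgetPex _ a [set b | [/\ Pi_nbhd U V a b, src b = x & tgt b = y]]
  (nbhd_ex nU nV Ua Va Ux Vy)).
Qed.

Lemma Pi_lift_eq U V a b : nice U -> nice V -> Pi_nbhd U V a b ->
  Pi_lift U V a (src b) (tgt b) = b.
Proof.
move=> nU nV ab; apply: xget_subset1 => // c d [ac sc tc] [ad sd td].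
by apply: (nbhd_uniq nU nV ac ad); rewrite ?sc ?tc.
Qed.

Lemma Pi_lift_continuous (T : topologicalType) U V a (x y : T -> X) (t : T) :
  nice U -> nice V -> U (src a) -> V (tgt a) -> U (x t) -> V (y t) ->
  {for t, continuous x} -> {for t, continuous y} ->
  {for t, continuous (fun s => Pi_lift U V a (x s) (y s))}.
Proof.
move=> nU nV Ua Va Ux Vy cx cy.
have nx : \forall s \near t, U (x s) by apply: cx; exact: nice_nbhsx nU Ux.
have ny : \forall s \near t, V (y s) by apply: cy; exact: nice_nbhsx nV Vy.
have lP : \forall s \near t, [/\ Pi_nbhd U V a (Pi_lift U V a (x s) (y s)),
    src (Pi_lift U V a (x s) (y s)) = x s & tgt (Pi_lift U V a (x s) (y s)) = y s].
  by apply: filterS (filterI nx ny) => s [? ?]; exact: Pi_liftP.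
apply: (lift_continuous (a := a) niceB nU nV).
- by apply: filterS lP => s [].
- by apply: near_eq_continuous cx; apply: filterS lP => s [].
- by apply: near_eq_continuous cy; apply: filterS lP => s [].
Qed.

Lemma mul_continuous_at (T : topologicalType) (h k : T -> Pi) (t : T) :
  (\forall s \near t, tgt (h s) = src (k s)) ->
  {for t, continuous h} -> {for t, continuous k} ->
  {for t, continuous (fun s => h s ** k s)}.
Proof.
move=> hk ch ck O /(mul_near niceB (nbhs_singleton hk))[Oh [Ok [nh nk hkO]]].
have sh : \forall s \near t, Oh (h s) by exact: ch nh.
have sk : \forall s \near t, Ok (k s) by exact: ck nk.
apply: filterS (filterI hk (filterI sh sk)) => s [e [? ?]].
exact: hkO.
Qed.

End Lift.

(** * Maps that are products of transition maps *)

Section Transitions.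
Context {R : realType} {n : nat} {M : topologicalType} {A : set (chart R n M)}.
Hypothesis smoothA : forall c d, A c -> A d -> smooth_compatible c d.
Implicit Types c d : chart R n M.

(** The shape of [h] is given pointwise through a witness [x], so that maps passing through [Pi] can
    be treated by exhibiting an endpoint of a class as [x]. *)
Lemma smooth_transition c c' (W : set 'rV[R]_n) (h : 'rV[R]_n -> 'rV[R]_n) :
  A c -> A c' -> open W ->
  (forall v, W v -> exists x, [/\ chart_dom c x, chart_dom c' x,
    v = chart_map c x & h v = chart_map c' x]) -> Cinfty W h.
Proof.
move=> Ac Ac' oW hE r.
have := smoothA Ac Ac' r => /(@Cr_sub _ _ _ _ _ W).
move=> /(_ _)/(eq_Cr oW); apply.
  by move=> v /hE[x [cx c'x vE ->]]; rewrite /= vE chart_mapK.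
by move=> v /hE[x [cx c'x -> _]]; split; rewrite /= ?chart_mapK//; exact: chart_mapP.
Qed.

Lemma smooth_transition_l c c' d (W : set 'rV[R]_(n + n))
    (h : 'rV[R]_(n + n) -> 'rV[R]_n) :
  A c -> A c' -> open W ->
  (forall v, W v -> exists x y, [/\ chart_dom c x, chart_dom c' x,
    v = row_mx (chart_map c x) (chart_map d y) & h v = chart_map c' x]) ->
  Cinfty W h.
Proof.
move=> Ac Ac' oW hE r.
apply: (eq_Cr (f := fun v => (chart_map c' \o chart_inv c) (lsubmx v)) oW);
  last apply: Cr_sub (@Cr_comp_lsubmx _ n n n r _ _ (smoothA Ac Ac' r)).
  by move=> v /hE[x [y [cx c'x vE ->]]]; rewrite /= vE row_mxKl chart_mapK.
move=> v /hE[x [y [cx c'x -> _]]].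
by split; rewrite /= row_mxKl ?chart_mapK//; exact: chart_mapP.
Qed.

Lemma smooth_transition_r c d d' (W : set 'rV[R]_(n + n))
    (h : 'rV[R]_(n + n) -> 'rV[R]_n) :
  A d -> A d' -> open W ->
  (forall v, W v -> exists x y, [/\ chart_dom d y, chart_dom d' y,
    v = row_mx (chart_map c x) (chart_map d y) & h v = chart_map d' y]) ->
  Cinfty W h.
Proof.
move=> Ad Ad' oW hE r.
apply: (eq_Cr (f := fun v => (chart_map d' \o chart_inv d) (rsubmx v)) oW);
  last apply: Cr_sub (@Cr_comp_rsubmx _ n n n r _ _ (smoothA Ad Ad' r)).
  by move=> v /hE[x [y [dy d'y vE ->]]]; rewrite /= vE row_mxKr chart_mapK.
move=> v /hE[x [y [dy d'y -> _]]].
by split; rewrite /= row_mxKr ?chart_mapK//; exact: chart_mapP.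
Qed.

Lemma smooth_transition2 c c' d d' (W : set 'rV[R]_(n + n))
    (h : 'rV[R]_(n + n) -> 'rV[R]_(n + n)) :
  A c -> A c' -> A d -> A d' -> open W ->
  (forall v, W v -> exists x y,
    [/\ chart_dom c x /\ chart_dom c' x, chart_dom d y /\ chart_dom d' y,
      v = row_mx (chart_map c x) (chart_map d y) &
      h v = row_mx (chart_map c' x) (chart_map d' y)]) ->
  Cinfty W h.
Proof.
move=> Ac Ac' Ad Ad' oW hE r.
have hl : Cr r W (fun v => lsubmx (h v)).
  apply: (@smooth_transition_l c c' d W _ Ac Ac' oW) => v /hE[x [y]].
  by move=> [[cx c'x] [dy d'y] vE hvE]; exists x, y; rewrite hvE row_mxKl.
have hr : Cr r W (fun v => rsubmx (h v)).
  apply: (@smooth_transition_r c d d' W _ Ad Ad' oW) => v /hE[x [y]].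
  by move=> [[cx c'x] [dy d'y] vE hvE]; exists x, y; rewrite hvE row_mxKr.
by apply: eq_Cr (Cr_row_mx oW hl hr) => // v _; rewrite hsubmxK.
Qed.

End Transitions.

(** * The smooth atlas of Pi(M) *)

Section PiAtlas.
Context {R : realType} {n : nat} {M : topologicalType} {A : set (chart R n M)}.
Local Notation Pi := (Pi R M).
Local Notation src := (@Pi_src R M).
Local Notation tgt := (@Pi_tgt R M).
Local Notation nice := (@nice R M).
Hypothesis atlasA : smooth_atlas A.

Let niceB : basis nice := nice_basis atlasA.1.
Let smoothA := atlasA.2.

Definition Pi_atlas : set (chart R (n + n) Pi) :=
  [set e | exists c d, [/\ A c, A d & forall a, chart_dom e a ->
    [/\ chart_dom c (src a), chart_dom d (tgt a) &
      chart_map e a = row_mx (chart_map c (src a)) (chart_map d (tgt a))]]].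

Let chart_nice (c : chart R n M) x : chart_dom c x ->
  exists U, [/\ nice U, U x & U `<=` chart_dom c].
Proof.
move=> cx; apply: (nice_nbhs niceB).
exact: open_nbhs_nbhs (conj (chart_dom_open c) cx).
Qed.

Section PiChart.
Context (c d : chart R n M) (U V : set M) (a : Pi).
Hypotheses (nU : nice U) (nV : nice V) (Ua : U (src a)) (Va : V (tgt a)).
Hypotheses (Uc : U `<=` chart_dom c) (Vd : V `<=` chart_dom d).

Let cod : set 'rV[R]_(n + n) :=
  [set v | (chart_cod c `&` chart_inv c @^-1` U) (lsubmx v)] `&`
  [set v | (chart_cod d `&` chart_inv d @^-1` V) (rsubmx v)].
Let map (b : Pi) : 'rV[R]_(n + n) :=
  row_mx (chart_map c (src b)) (chart_map d (tgt b)).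
Let inv (v : 'rV[R]_(n + n)) : Pi :=
  Pi_lift U V a (chart_inv c (lsubmx v)) (chart_inv d (rsubmx v)).

Let dom_open : open (Pi_nbhd U V a).
Proof. exact: nbhd_open. Qed.

Let cod_open : open cod.
Proof.
apply: openI; apply: open_comp; [by move=> v _; exact: lsubmx_continuous|
  by apply: open_chart_preimage; have [] := nU|
  by move=> v _; exact: rsubmx_continuous|
  by apply: open_chart_preimage; have [] := nV].
Qed.

Let mapP b : Pi_nbhd U V a b -> cod (map b).
Proof.
move=> ab; have Ub := src_nbhd ab; have Vb := tgt_nbhd ab.
have cb := Uc Ub; have db := Vd Vb.
split; rewrite /map /= ?row_mxKl ?row_mxKr; split; rewrite /= ?chart_mapK//;
  exact: chart_mapP.
Qed.

Let liftP v : cod v -> [/\ Pi_nbhd U V a (inv v),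
  src (inv v) = chart_inv c (lsubmx v) & tgt (inv v) = chart_inv d (rsubmx v)].
Proof. by move=> [[cv Uv] [dv Vv]]; exact: Pi_liftP. Qed.

Let invP v : cod v -> Pi_nbhd U V a (inv v).
Proof. by move=> /liftP[]. Qed.

Let mapK b : Pi_nbhd U V a b -> inv (map b) = b.
Proof.
move=> ab; have cb := Uc (src_nbhd ab); have db := Vd (tgt_nbhd ab).
by rewrite /inv /map row_mxKl row_mxKr !chart_mapK//; exact: Pi_lift_eq.
Qed.

Let invK v : cod v -> map (inv v) = v.
Proof.
move=> cv; have [_ srcE tgtE] := liftP cv; case: cv => -[cv _] [dv _].
by rewrite /map srcE tgtE !chart_invK// hsubmxK.
Qed.

Let map_cts b : Pi_nbhd U V a b -> {for b, continuous map}.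
Proof.
move=> ab; have cb := Uc (src_nbhd ab); have db := Vd (tgt_nbhd ab).
apply: row_mx_continuous_at.
  by apply: continuous_comp; [exact: src_continuous|exact: chart_map_cts].
by apply: continuous_comp; [exact: tgt_continuous|exact: chart_map_cts].
Qed.

Let inv_cts v : cod v -> {for v, continuous inv}.
Proof.
move=> [[cv Uv] [dv Vv]]; apply: Pi_lift_continuous => //.
  by apply: continuous_comp; [exact: lsubmx_continuous|exact: chart_inv_cts].
by apply: continuous_comp; [exact: rsubmx_continuous|exact: chart_inv_cts].
Qed.

Definition Pi_chart : chart R (n + n) Pi :=
  Chart dom_open cod_open mapP invP mapK invK map_cts inv_cts.

End PiChart.

Lemma Pi_atlas_cover a : exists2 e, Pi_atlas e & chart_dom e a.
Proof.
have [c Ac ca] := atlasA.1 (src a); have [d Ad da] := atlasA.1 (tgt a).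
have [U [nU Ua Uc]] := chart_nice ca; have [V [nV Va Vd]] := chart_nice da.
exists (Pi_chart nU nV Ua Va Uc Vd); last exact: nbhd_self.
exists c, d; split=> // b ab; split=> //.
  exact: Uc (src_nbhd ab).
exact: Vd (tgt_nbhd ab).
Qed.

Lemma Pi_smooth_atlas : smooth_atlas Pi_atlas.
Proof.
split; first exact: Pi_atlas_cover.
move=> e e' [c [d [Ac Ad eE]]] [c' [d' [Ac' Ad' e'E]]].
apply: (smooth_transition2 smoothA Ac Ac' Ad Ad').
  exact/open_chart_preimage/chart_dom_open.
move=> v [ev e'v]; have [cb db bE] := eE _ (chart_invP ev).
have [c'b d'b b'E] := e'E _ e'v.
exists (src (chart_inv e v)), (tgt (chart_inv e v)).
by rewrite -bE chart_invK.
Qed.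

Lemma Pi_smooth_manifold : hausdorff_space M -> @second_countable M ->
  smooth_manifold Pi_atlas.
Proof.
move=> hM cM; split; [exact: Pi_hausdorff|exact: Pi_second_countable|].
exact: Pi_smooth_atlas.
Qed.

(** In charts the source map is the projection to the left block followed by a transition map of
    [M]. *)
Lemma Pi_src_smooth : smooth_on Pi_atlas A setT src.
Proof.
split; first by move=> a _; exact: src_continuous.
move=> e c' [c [d [Ac Ad eE]]] Ac'.
apply: (smooth_transition_l (d := d) smoothA Ac Ac').
  by apply: open_smooth_dom; [exact: openT|move=> a _; exact: src_continuous].
move=> v [ev [[_ ?] c'v]]; have [cb db bE] := eE _ (chart_invP ev).
exists (src (chart_inv e v)), (tgt (chart_inv e v)).
by rewrite -bE chart_invK.
Qed.

(** * The fiber of the source map *)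

Section Fiber.
Context (x0 : M).

Local Notation F := (set_type [set a : Pi | src a = x0]).

Let src_val (w : F) : src (set_val w) = x0.
Proof. by case: w => a Pa; rewrite set_valE; exact: (set_mem Pa). Qed.

Let insubdE (w : F) a : src a = x0 -> set_val (insubd w a : F) = a.
Proof. by move=> ax; rewrite set_valE insubdK// inE. Qed.

Definition fiber_atlas : set (chart R n F) :=
  [set e | exists2 d, A d & forall w, chart_dom e w ->
    chart_dom d (tgt (set_val w)) /\
    chart_map e w = chart_map d (tgt (set_val w))].

Section FiberChart.
Context (d : chart R n M) (U V : set M) (w : F).
Hypotheses (nU : nice U) (nV : nice V) (Ux : U x0) (Vw : V (tgt (set_val w))).
Hypothesis (Vd : V `<=` chart_dom d).

Let Uw : U (src (set_val w)).
Proof. by rewrite src_val. Qed.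

Let dom : set F := set_val @^-1` Pi_nbhd U V (set_val w).
Let cod : set 'rV[R]_n := chart_cod d `&` chart_inv d @^-1` V.
Let map (b : F) : 'rV[R]_n := chart_map d (tgt (set_val b)).
(** For [v] in [cod] the lift starts at [x0], so [insubd] returns the lift itself. *)
Let inv (v : 'rV[R]_n) : F :=
  insubd w (Pi_lift U V (set_val w) x0 (chart_inv d v)).

Let dom_open : open dom.
Proof.
apply: open_comp; first by move=> ? _; exact: set_val_continuous.
exact: nbhd_open.
Qed.

Let cod_open : open cod.
Proof. by apply: open_chart_preimage; have [] := nV. Qed.

Let liftP v : cod v -> [/\ Pi_nbhd U V (set_val w) (set_val (inv v)) &
  tgt (set_val (inv v)) = chart_inv d v].
Proof.
move=> [dv Vv]; have [h1 h2 h3] := Pi_liftP nU nV Uw Vw Ux Vv.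
by rewrite /inv insubdE.
Qed.

Let mapP b : dom b -> cod (map b).
Proof.
move=> wb; have Vb := tgt_nbhd wb; have db := Vd Vb.
by split; rewrite /map /= ?chart_mapK//; exact: chart_mapP.
Qed.

Let invP v : cod v -> dom (inv v).
Proof. by move=> /liftP[]. Qed.

Let mapK b : dom b -> inv (map b) = b.
Proof.
move=> wb; have db := Vd (tgt_nbhd wb); apply: val_inj.
have := Pi_lift_eq nU nV wb; rewrite src_val => liftE.
by rewrite /inv /map chart_mapK// liftE; exact: insubdE.
Qed.

Let invK v : cod v -> map (inv v) = v.
Proof.
by move=> cv; have [_ tgtE] := liftP cv; rewrite /map tgtE chart_invK//; case: cv.
Qed.

Let map_cts b : dom b -> {for b, continuous map}.
Proof.
move=> wb; have db := Vd (tgt_nbhd wb).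
apply: continuous_comp; last exact: chart_map_cts.
by apply: continuous_comp; [exact: set_val_continuous|exact: tgt_continuous].
Qed.

Let inv_cts v : cod v -> {for v, continuous inv}.
Proof.
move=> cv; have [dv Vv] := cv; apply: subtype_continuous_at.
have ncod : \forall u \near v, cod u.
  exact: open_nbhs_nbhs (conj cod_open cv).
apply: near_eq_continuous
  (@Pi_lift_continuous _ _ niceB _ U V (set_val w) (fun=> x0) (chart_inv d) v
     nU nV Uw Vw Ux Vv _ _).
- apply: filterS ncod => u [du Vu].
  by have [_ srcE _] := Pi_liftP nU nV Uw Vw Ux Vu; rewrite /= /inv insubdE.
- exact: cst_continuous.
- exact: chart_inv_cts.
Qed.

Definition fiber_chart : chart R n F :=
  Chart dom_open cod_open mapP invP mapK invK map_cts inv_cts.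

End FiberChart.

Lemma fiber_smooth_atlas : smooth_atlas fiber_atlas.
Proof.
split.
  move=> w; have [d Ad dw] := atlasA.1 (tgt (set_val w)).
  have [V [nV Vw Vd]] := chart_nice dw.
  have [U [nU Ux _]] := nice_nbhs niceB (@filterT _ (nbhs x0) _).
  exists (fiber_chart nU nV Ux Vw Vd).
    by exists d => // b wb; split=> //; exact: Vd (tgt_nbhd wb).
  by apply: nbhd_self; rewrite ?src_val.
move=> e e' [d Ad eE] [d' Ad' e'E].
apply: (smooth_transition smoothA Ad Ad').
  exact/open_chart_preimage/chart_dom_open.
move=> v [ev e'v]; have [db bE] := eE _ (chart_invP ev).
have [d'b b'E] := e'E _ e'v.
by exists (tgt (set_val (chart_inv e v))); rewrite -bE chart_invK.
Qed.

Lemma fiber_smooth_manifold : hausdorff_space M -> @second_countable M ->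
  smooth_manifold fiber_atlas.
Proof.
move=> hM cM; split; last exact: fiber_smooth_atlas.
  exact/subtype_hausdorff/Pi_hausdorff.
exact/subtype_second_countable/Pi_second_countable.
Qed.

(** * Local trivializations of the source map *)

Section Trivialization.
Context (U0 U : set M) (k0 : Pi).
Hypotheses (nU0 : nice U0) (nU : nice U) (U0x : U0 x0) (srck0 : src k0 = x0).
Hypothesis Uk0 : U (tgt k0).

(* A continuous choice of a path from [x0] to the points of [U]. *)
Let kappa (u : M) : Pi := Pi_lift U0 U k0 x0 u.

Let kappaP u : U u -> src (kappa u) = x0 /\ tgt (kappa u) = u.
Proof.
move=> Uu; have U0k0 : U0 (src k0) by rewrite srck0.
by have [_ ? ?] := Pi_liftP nU0 nU U0k0 Uk0 U0x Uu.
Qed.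

Let kappa_cts u : U u -> {for u, continuous kappa}.
Proof.
move=> Uu; have U0k0 : U0 (src k0) by rewrite srck0.
apply: (@Pi_lift_continuous _ _ niceB _ U0 U k0 (fun=> x0) id) => //.
exact: cst_continuous.
Qed.

(** [insubd] demands a default value; over [U] its argument already lies in the fiber, by
    [src_kappa_mul]. *)
Let w0 : F := insubd (exist _ (Pi_id x0) (mem_set (src_id x0))) (Pi_id x0).

Definition trivialization (a : Pi) : M * F :=
  (src a, insubd w0 (kappa (src a) ** a)).

Definition trivialization_inv (uw : M * F) : Pi :=
  Pi_inv (kappa uw.1) ** set_val uw.2.

Let src_kappa_mul a : U (src a) -> src (kappa (src a) ** a) = x0.
Proof. by move=> /kappaP[? ?]; rewrite src_mul. Qed.

Let val_triv a : U (src a) ->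
  set_val (trivialization a).2 = kappa (src a) ** a.
Proof. by move=> Ua; rewrite insubdE// src_kappa_mul. Qed.

Let inv_endpoints uw : U uw.1 ->
  src (trivialization_inv uw) = uw.1 /\
  tgt (trivialization_inv uw) = tgt (set_val uw.2).
Proof.
move=> /kappaP[ks kt]; rewrite /trivialization_inv src_mul ?tgt_mul ?src_inv//;
  by rewrite tgt_inv ks src_val.
Qed.

Let trivializationK a : U (src a) -> trivialization_inv (trivialization a) = a.
Proof.
move=> Ua; have [ks kt] := kappaP Ua.
by rewrite /trivialization_inv val_triv// mulVK.
Qed.

Let trivialization_invK uw : U uw.1 ->
  trivialization (trivialization_inv uw) = uw.
Proof.
case: uw => u w /= Uu; have [ks kt] := kappaP Uu.
have /= [srcE _] := @inv_endpoints (u, w) Uu.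
have mulE : kappa u ** trivialization_inv (u, w) = set_val w.
  by rewrite mulKV// ks src_val.
rewrite /trivialization srcE mulE; congr pair.
by apply: val_inj; exact: insubdE.
Qed.

Let near_src a : U (src a) -> \forall b \near a, U (src b).
Proof. by move=> Ua; exact: (src_continuous niceB) (nice_nbhsx nU Ua). Qed.

Let trivialization_cts a : U (src a) -> {for a, continuous trivialization}.
Proof.
move=> Ua; pose g b : F := insubd w0 (kappa (src b) ** b).
change {for a, continuous (fun b => (src b, g b))}.
apply: pair_continuous_at; first exact: src_continuous.
apply: subtype_continuous_at.
have nU_a := near_src Ua.
apply: (@near_eq_continuous _ _ (fun b => kappa (src b) ** b)).
  by apply: filterS nU_a => b Ub; rewrite -val_triv.
apply: mul_continuous_at => //.
  by apply: filterS nU_a => b /kappaP[].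
by apply: continuous_comp; [exact: src_continuous|exact: kappa_cts].
Qed.

Let trivialization_inv_cts uw : U uw.1 ->
  {for uw, continuous trivialization_inv}.
Proof.
move=> Uu; apply: mul_continuous_at => //.
- have nu : \forall vw \near uw, U vw.1.
    by exact: (@cvg_fst _ _ _ _ _ _) (nice_nbhsx nU Uu).
  by apply: filterS nu => vw /kappaP[ks _]; rewrite tgt_inv ks src_val.
- apply: continuous_comp; last exact: inv_continuous.
  by apply: continuous_comp; [exact: cvg_fst|exact: kappa_cts].
- by apply: continuous_comp; [exact: cvg_snd|exact: set_val_continuous].
Qed.

(** Multiplying by [kappa] on the left changes only the source, which the first component records.
    In charts both maps thus rewrite the coordinates of one pair of endpoints, as
    [smooth_transition2] requires. *)
Lemma trivialization_diffeo :
  diffeomorphism_on Pi_atlas (prod_atlas A fiber_atlas)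
    (src @^-1` U) (U `*` setT) trivialization trivialization_inv.
Proof.
have oU : open U by have [] := nU.
have osU : open (src @^-1` U).
  by apply: open_comp => // ? _; exact: src_continuous.
have oUT : open (U `*` [set: F]).
  rewrite openE => -[u w] [/= Uu _]; exists (U, setT) => //.
  by split; [exact: open_nbhs_nbhs|exact: filterT].
split => //.
- by move=> a Ua; split; [split|exact: trivializationK].
- move=> uw [Uu _]; split; last exact: trivialization_invK.
  by rewrite /= (inv_endpoints Uu).1.
- split; first by move=> a; exact: trivialization_cts.
  move=> e _ [c [d [Ac Ad eE]]] [c' [k [Ac' [d' Ad' kE] ->]]].
  apply: (smooth_transition2 smoothA Ac Ac' Ad Ad').
    by apply: open_smooth_dom => // a; exact: trivialization_cts.
  move=> v [ev [[Uv _] [c'v kv]]]; have [cb db bE] := eE _ (chart_invP ev).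
  have [d'b b'E] := kE _ kv.
  set a := chart_inv e v in Uv c'v kv cb db bE d'b b'E *.
  have tgtE : tgt (set_val (trivialization a).2) = tgt a.
    by rewrite val_triv// tgt_mul//; exact: (kappaP Uv).2.
  rewrite tgtE in d'b b'E.
  exists (src a), (tgt a); rewrite -bE chart_invK//; split => //.
  by rewrite -b'E.
- split; first by move=> uw [Uu _]; exact: trivialization_inv_cts.
  move=> _ e' [c [k [Ac [d Ad kE] ->]]] [c' [d' [Ac' Ad' e'E]]].
  apply: (smooth_transition2 smoothA Ac Ac' Ad Ad').
    by apply: open_smooth_dom => // uw [Uu _]; exact: trivialization_inv_cts.
  move=> v [[cv kv] [[[Uv _] [cuw kuw]] e'v]].
  set uw := chart_inv _ v in Uv cuw kuw e'v.
  have [dw wE] := kE _ kuw; have [c'b d'b bE] := e'E _ e'v.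
  have [srcE tgtE] := inv_endpoints Uv; rewrite srcE tgtE in c'b d'b bE.
  (* The base point and the target of the fiber component are the endpoints of the class produced by
     the inverse. *)
  exists uw.1, (tgt (set_val uw.2)); split => //.
  by rewrite -wE /uw /= !chart_invK// hsubmxK.
Qed.

End Trivialization.
End Fiber.

Lemma Pi_src_fiber_bundle : hausdorff_space M -> @second_countable M ->
  connected [set: M] -> smooth_fiber_bundle Pi_atlas A src.
Proof.
move=> hM cM conM; split; first exact: Pi_src_smooth.
  by move=> x; exists (Pi_id x); exact: src_id.
(* Over an empty base any manifold can serve as the fiber; [M] itself is taken. *)
have [[x0 _]|M0] := pselect (exists x0 : M, True); last first.
  by exists n, M, A; split=> // b; case: M0; exists b.
exists n, (set_type [set a : Pi | src a = x0]), (@fiber_atlas x0).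
split; first exact: fiber_smooth_manifold.
(* Connectedness provides a path from [x0] to [b], so one fiber serves around all points. *)
move=> b; have [k0 [srck tgtk]] := connected_Pi niceB x0 b conM.
have [U0 [nU0 U0x _]] := nice_nbhs niceB (@filterT _ (nbhs x0) _).
have [U [nU Ub _]] := nice_nbhs niceB (@filterT _ (nbhs b) _).
exists U, (trivialization x0 U0 U k0), (@trivialization_inv x0 U0 U k0).
split => //; first by have [] := nU.
by apply: trivialization_diffeo; rewrite ?tgtk.
Qed.

End PiAtlas.

Theorem proposition3p7 (R : realType) (n : nat) (M : topologicalType)
    (A : set (chart R n M))
    (manM : smooth_manifold A) (connM : connected [set: M]) :
  exists B : set (chart R (2 * n) (Pi R M)),
    smooth_manifold B /\ smooth_fiber_bundle B A (@Pi_src R M).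
Proof.
have [hM cM atlasA] := manM.
(* Charts of [Pi_atlas] take values in rows made of two blocks of size [n]; changing the dimension
   in the goal first spares a cast of the charts. *)
have -> : (2 * n = n + n)%N by rewrite mul2n addnn.
exists (@Pi_atlas R n M A); split; first exact: Pi_smooth_manifold.
exact: Pi_src_fiber_bundle.
Qed.
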